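(* Let $B$ be a finite set of Boolean functions such that $\oplus,\mathit{true}\in[B]$. Let $\kappa$ be a parameterization function for which there exists $c\in\mathbb{N}$ such that $\kappa(\Sigma)<c$ for all sets $\Sigma$ of autoepistemic $B$-formulae. If $\mathrm{L}\neq\oplus\mathrm{L}$, then the expansion existence problem for sets of autoepistemic $B$-formulae, parameterized by $\kappa$, is not contained in $\mathrm{XL}_{\mathrm{nu}}$.
   Context: $[B]$ is the clone generated by $B$ (Boolean functions expressible by $B$-formulae); $\oplus$ is binary exclusive or. Autoepistemic $B$-formulae: $\varphi ::= p \mid f(\varphi,\dots,\varphi)\mid L\varphi$ with $p$ a proposition, $f\in B$; formulae $L\varphi$ are treated as atoms for propositional consequence, and $\mathrm{Th}(S)$ is the consequence closure of $S$. $\Delta$ is a stable expansion of $\Sigma$ if $\Delta=\mathrm{Th}(\Sigma\cup\{L\varphi\mid\varphi\in\Delta\}\cup\{\neg L\varphi\mid\varphi\notin\Delta\})$. The expansion existence problem asks whether a given set $\Sigma$ has a stable expansion. For a parameterized problem $(P,\kappa)$, the $\ell$-th slice is $\{x\in P\mid\kappa(x)=\ell\}$; $(P,\kappa)\in\mathrm{XL}_{\mathrm{nu}}$ iff every slice is decidable in deterministic logarithmic space. $\mathrm{L}$ is deterministic logspace and $\oplus\mathrm{L}$ is parity logspace. *)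

(* Defs.v *)
From Stdlib Require Import BinNat List.
From mathcomp Require Import all_boot.

Set Implicit Arguments.
Unset Strict Implicit.
Unset Printing Implicit Defensive.

Inductive Dir := Lft | Stay | Rgt.

Record NTM := {
  tm_ns : nat;
  tm_delta : 'I_tm_ns -> option bool -> bool ->
             seq ('I_tm_ns * bool * Dir * Dir);
  (* state, input symbol (None = end marker), work symbol  |->
     list of (new state, symbol written on work tape, input move, work move) *)
  tm_start : 'I_tm_ns;
  tm_halt : 'I_tm_ns -> bool;
  tm_acc : 'I_tm_ns -> bool }.

(* configuration: state, input head, work tape contents, work head *)
Definition config (M : NTM) := ('I_(tm_ns M) * nat * (nat -> bool) * nat)%type.

Definition init_config (M : NTM) : config M :=
  (@tm_start M, 0, (fun _ => false), 0).

(* input positions: 0 = left marker, 1..|x| = symbols, |x|+1 = right marker *)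
Definition read_input (x : seq bool) (i : nat) : option bool :=
  if (0 < i) && (i <= size x) then Some (nth false x i.-1) else None.

Definition move_in (x : seq bool) (d : Dir) (i : nat) : nat :=
  match d with Lft => i.-1 | Stay => i | Rgt => minn i.+1 (size x).+1 end.

Definition move_work (d : Dir) (i : nat) : nat :=
  match d with Lft => i.-1 | Stay => i | Rgt => i.+1 end.

Definition step (M : NTM) (x : seq bool) (c : config M) : seq (config M) :=
  let: (q, i, w, j) := c in
  map (fun t : 'I_(tm_ns M) * bool * Dir * Dir =>
         let: (q', b, di, dw) := t in
         (q', move_in x di i,
          (fun k => if k == j then b else w k), move_work dw j))
      (@tm_delta M q (read_input x i) (w j)).

Definition cstate (M : NTM) (c : config M) : 'I_(tm_ns M) :=
  let: (q, _, _, _) := c in q.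
Definition cwpos (M : NTM) (c : config M) : nat :=
  let: (_, _, _, j) := c in j.

Fixpoint good (M : NTM) (x : seq bool) (s : nat) (fuel : nat) (c : config M)
  : Prop :=
  cwpos c <= s /\
  (@tm_halt M (cstate c) \/
   match fuel with
   | 0 => False
   | f.+1 => forall c', List.In c' (step x c) -> good x s f c'
   end).

Fixpoint acc_paths (M : NTM) (x : seq bool) (fuel : nat) (c : config M) : nat :=
  if @tm_halt M (cstate c) then nat_of_bool (@tm_acc M (cstate c)) else
  match fuel with
  | 0 => 0
  | f.+1 => sumn (map (acc_paths x f) (step x c))
  end.

Definition deterministic (M : NTM) : Prop :=
  forall q a b, size (@tm_delta M q a b) <= 1.

Definition log_space (k : nat) (x : seq bool) : nat :=
  k * (trunc_log 2 (size x)).+1.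

Definition language := seq bool -> Prop.

Definition in_L (A : language) : Prop :=
  exists (M : NTM) (k : nat), deterministic M /\
    forall x, exists fuel, good x (log_space k x) fuel (init_config M) /\
      (A x <-> 0 < acc_paths x fuel (init_config M)).

Definition in_ParityL (A : language) : Prop :=
  exists (M : NTM) (k : nat),
    forall x, exists fuel, good x (log_space k x) fuel (init_config M) /\
      (A x <-> odd (acc_paths x fuel (init_config M))).

Definition L_eq_ParityL : Prop := forall A : language, in_L A <-> in_ParityL A.

Definition in_XLnu (P : language) (kappa : seq bool -> nat) : Prop :=
  forall l : nat, in_L (fun x => P x /\ kappa x = l).

(* a Boolean function of arity bf_arity (only its values on argument lists of
   length bf_arity are relevant) *)
Record BoolFun := { bf_arity : nat; bf_fun : seq bool -> bool }.

Definition dflt_bf : BoolFun := {| bf_arity := 0; bf_fun := fun _ => false |}.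

Inductive aeform :=
| AVar (p : nat)
| AApp (i : nat) (args : seq aeform)   (* f_i(args), f_i the i-th element of B *)
| AL (phi : aeform).

Fixpoint wf (B : seq BoolFun) (phi : aeform) : bool :=
  match phi with
  | AVar _ => true
  | AApp i args => (i < size B) &&
                   (size args == bf_arity (nth dflt_bf B i)) &&
                   all (wf B) args
  | AL psi => wf B psi
  end.

Fixpoint pure (phi : aeform) : bool :=
  match phi with
  | AVar _ => true
  | AApp _ args => all pure args
  | AL _ => false
  end.

Fixpoint eval (B : seq BoolFun) (vp : nat -> bool) (vL : aeform -> bool)
  (phi : aeform) : bool :=
  match phi with
  | AVar p => vp p
  | AApp i args => bf_fun (nth dflt_bf B i) (map (eval B vp vL) args)
  | AL psi => vL psi
  end.

Definition in_clone (B : seq BoolFun) (n : nat) (f : seq bool -> bool) : Prop :=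
  exists phi, wf B phi /\ pure phi /\
    forall vp vL, eval B vp vL phi = f (mkseq vp n).

Definition xor_fun (s : seq bool) : bool := addb (nth false s 0) (nth false s 1).

(* Delta is a stable expansion of Sigma (all sets consist of B-formulae):
   Delta = Th(Sigma u {L phi | phi in Delta} u {~ L phi | phi notin Delta}) *)
Definition stable_expansion (B : seq BoolFun) (Sigma : seq aeform)
  (Delta : aeform -> Prop) : Prop :=
  (forall phi, Delta phi -> wf B phi) /\
  forall phi, wf B phi ->
    (Delta phi <->
     forall (vp : nat -> bool) (vL : aeform -> bool),
       (forall psi, wf B psi -> (vL psi = true <-> Delta psi)) ->
       (forall sigma, List.In sigma Sigma -> eval B vp vL sigma = true) ->
       eval B vp vL phi = true).

(* self-delimiting binary code: pairs "1 b" (least significant first), "0" ends *)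
Fixpoint enc_pos (p : positive) : seq bool :=
  match p with
  | xH => [:: true; true]
  | xO q => [:: true; false] ++ enc_pos q
  | xI q => [:: true; true] ++ enc_pos q
  end.

Definition enc_nat (n : nat) : seq bool :=
  match N.of_nat n with
  | N0 => [:: false]
  | Npos p => enc_pos p ++ [:: false]
  end.

Fixpoint enc_form (phi : aeform) : seq bool :=
  match phi with
  | AVar p => [:: false; false] ++ enc_nat p
  | AApp i args => [:: false; true] ++ enc_nat i ++ enc_nat (size args) ++
                   flatten (map enc_form args)
  | AL psi => [:: true; false] ++ enc_form psi
  end.

Definition enc_inst (Sigma : seq aeform) : seq bool :=
  flatten (map (fun s => true :: enc_form s) Sigma) ++ [:: false].

Definition EXP (B : seq BoolFun) : language :=
  fun x => exists Sigma : seq aeform,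
    all (wf B) Sigma /\ enc_inst Sigma = x /\
    exists Delta, stable_expansion B Sigma Delta.

(* Main.v *)
(* The slices being finitely many, logspace deciders for them combine into one
   for expansion existence; it suffices to reduce every parity logspace language
   to it. A set S of objective formulae together with L p has a stable expansion
   iff S entails p. For a machine and an input, S is a triangular system of
   equations over GF(2), with one unknown for each time t and configuration c: the
   parity of the number of accepting paths of length at most t from c; p is the
   unknown of the initial configuration at a time which exceeds the length of
   every computation. Logspace computability is handled through bounded primitive
   recursion with polynomially bounded values, which counter programs, hence
   Turing machines, evaluate in logarithmic space. *)
Require Import Defs.
From Stdlib Require Import FunctionalExtensionality ClassicalEpsilon PArith NArith.
From mathcomp Require Import all_boot zify.

Set Implicit Arguments.
Unset Strict Implicit.
Unset Printing Implicit Defensive.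

(** A reduction cannot store its instance on the work tape, and the deciders of the slices are given
    only as machines. Both are therefore brought into one class of functions closed under
    composition: a machine becomes a bounded recursion on numeric codes of its configurations, its
    input being given by a length and a letter function, and only the final composite is compiled
    back into a machine. The unknowns carry a time because configurations that are never reached may
    lie on cycles; a system indexed by configurations alone could then have no solution or several.
    With the time index every unknown is determined, whether or not its configuration leads to a
    halt. Exclusive or and truth generate just the affine functions, so each equation is an instance
    of one formula fixed by the machine: the negated sum of a constant number of variables. Two
    variables forced to be false and true serve as constants and as padding. *)

(** * Binary digits of natural numbers *)

Fixpoint bit (n k : nat) : bool :=
  if k is k'.+1 then bit n./2 k' else odd n.

Lemma bit0 k : bit 0 k = false.
Proof. by elim: k. Qed.

Lemma bit_small n k : n < 2 ^ k -> bit n k = false.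
Proof.
elim: k n => [|k IH] n /=; first by case: n.
by rewrite expnS => h; apply: IH; lia.
Qed.

(** The carry passes the trailing ones and stops at the first zero [p]. The inequality
    [2 ^ p <= n.+1] bounds the stretch of tape that an increment visits. *)
Lemma bit_succ n : exists p, [/\ 2 ^ p <= n.+1, forall k, k < p -> bit n k,
  ~~ bit n p & forall k, bit n.+1 k = if k <= p then ~~ bit n k else bit n k].
Proof.
have [m] := ubnP n; elim: m n => // m IH n le_nm.
case: (boolP (odd n)) => on; last first.
  exists 0; split=> // -[|k] //=.
  by congr (bit _ k); lia.
have [|p [h1 h2 h3 h4]] := IH n./2; first lia.
exists p.+1; split=> //.
- by rewrite expnS; lia.
- by case=> [|k] //= /h2.
case=> [|k] //=; rewrite ltnS -h4; congr (bit _ k); lia.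
Qed.

(** The borrow undoes the carry of the predecessor: [p] is the lowest digit 1. The same [p] is where
    a test for zero finds out that [n] is positive. *)
Lemma bit_pred n : 0 < n -> exists p, [/\ 2 ^ p <= n,
  forall k, k < p -> ~~ bit n k, bit n p &
  forall k, bit n.-1 k = if k <= p then ~~ bit n k else bit n k].
Proof.
case: n => // n _; have [p [h1 h2 h3 h4]] := bit_succ n; exists p; split=> //=.
- by move=> k kp; rewrite h4 ltnW // h2.
- by rewrite h4 leqnn h3.
by move=> k; rewrite h4; case: leqP; rewrite ?negbK.
Qed.

Lemma bit_half_iter n k : bit n k = odd (iter k half n).
Proof. by elim: k n => //= k IH n; rewrite IH -iterSr. Qed.

(** * Counter programs *)

Definition store := nat -> nat.
Definition upd (s : store) r v : store := fun r' => if r' == r then v else s r'.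

Inductive instr :=
| IInc (r n : nat) | IDec (r n : nat) | IJz (r lz ln : nat)
| ILeft (n : nat) | IRight (n : nat) | IInp (lN l0 l1 : nat) | IHalt (b : bool).

Definition istep (x : seq bool) (i : instr) (s : store) (h : nat)
  : nat * store * nat :=
  match i with
  | IInc r n => (n, upd s r (s r).+1, h)
  | IDec r n => (n, upd s r (s r).-1, h)
  | IJz r lz ln => (if s r == 0 then lz else ln, s, h)
  | ILeft n => (n, s, h.-1)
  | IRight n => (n, s, minn h.+1 (size x).+1)
  | IInp lN l0 l1 =>
      (if read_input x h is Some b then (if b then l1 else l0) else lN, s, h)
  | IHalt _ => (0, s, h)
  end.

(** Bounds the register contents along a run, from which the tape bound is derived, and excludes
    decrementing 0, where a binary borrow would find no digit 1. *)
Definition guard (B : nat) (i : instr) (s : store) : bool :=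
  match i with
  | IInc r _ => s r < B
  | IDec r _ => 0 < s r
  | IHalt _ => false
  | _ => true
  end.

Definition fetch (P : seq instr) pc := nth (IHalt false) P pc.

Inductive star (P : seq instr) (B : nat) (x : seq bool) :
  nat * store * nat -> nat * store * nat -> Prop :=
| star0 c : star P B x c c
| starS pc s h c : pc < size P -> guard B (fetch P pc) s ->
    star P B x (istep x (fetch P pc) s h) c -> star P B x (pc, s, h) c.

Lemma star_trans P B x c1 c2 c3 :
  star P B x c1 c2 -> star P B x c2 c3 -> star P B x c1 c3.
Proof. by elim=> // pc s h c h1 h2 _ IH /IH; apply: starS. Qed.

(** * Program fragments and their specifications *)

(** Jump targets are absolute, so a fragment depends on the address at which it is placed. *)
Definition code := nat -> seq instr.

Definition located (P : seq instr) a (l : seq instr) :=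
  exists p q, P = p ++ l ++ q /\ size p = a.

(** A total-correctness triple for a single pair of states, valid wherever the fragment occurs in a
    program: control enters at its first instruction and leaves just behind its last one. *)
Definition triple x B (c : code) (st st' : store * nat) :=
  forall P a, located P a (c a) ->
  star P B x (a, st.1, st.2) (a + size (c a), st'.1, st'.2).

Lemma located_catl P a l1 l2 : located P a (l1 ++ l2) -> located P a l1.
Proof. by case=> p [q [-> <-]]; exists p, (l2 ++ q); rewrite !catA. Qed.

Lemma located_catr P a l1 l2 :
  located P a (l1 ++ l2) -> located P (a + size l1) l2.
Proof.
by case=> p [q [-> <-]]; exists (p ++ l1), q; rewrite size_cat !catA.
Qed.

Lemma located_fetch P a i l : located P a (i :: l) ->
  a < size P /\ fetch P a = i.
Proof.
by case=> p [q [-> <-]]; rewrite /fetch nth_cat ltnn subnn size_cat /= -addSnnS leq_addr.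
Qed.

Definition cskip : code := fun _ => [::].
Definition cone (i : nat -> instr) : code := fun a => [:: i a.+1].
Definition cseq (c1 c2 : code) : code :=
  fun a => let l := c1 a in l ++ c2 (a + size l).
(** The test [t] takes its exit and its body address; the closing [IJz 0 a a], with equal targets,
    is an unconditional jump back to it. *)
Definition cwhile (t : nat -> nat -> instr) (c : code) : code :=
  fun a => let l := c a.+1 in
    t (a + size l).+2 a.+1 :: l ++ [:: IJz 0 a a].

Lemma triple_skip x B st : triple x B cskip st st.
Proof. by move=> P a _; rewrite addn0; apply: star0. Qed.

Lemma triple_seq x B c1 c2 st1 st2 st3 :
  triple x B c1 st1 st2 -> triple x B c2 st2 st3 ->
  triple x B (cseq c1 c2) st1 st3.
Proof.
move=> h1 h2 P a loc; apply: star_trans (h1 P a (located_catl loc)) _.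
by rewrite /cseq size_cat addnA; apply/h2/located_catr.
Qed.

Lemma triple_one x B i s h s' h' :
  (forall n, guard B (i n) s /\ istep x (i n) s h = (n, s', h')) ->
  triple x B (cone i) (s, h) (s', h').
Proof.
move=> hi P a /located_fetch[lt_a fe]; have [g e] := hi a.+1.
by apply: starS; rewrite ?fe ?e ?addn1 //; apply: star0.
Qed.

(** [st k] is the state at the [k]-th test: the whole trace of the loop is supplied in place of an
    invariant. *)
Lemma triple_while x B t (cond : store * nat -> bool) c (st : nat -> store * nat) n :
  (forall e b st, guard B (t e b) st.1 /\
     istep x (t e b) st.1 st.2 = (if cond st then b else e, st.1, st.2)) ->
  (forall k, k < n -> cond (st k) /\ triple x B c (st k) (st k.+1)) ->
  ~~ cond (st n) ->
  triple x B (cwhile t c) (st 0) (st n).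
Proof.
move=> ht hc hn P a; rewrite /cwhile; set l := c a.+1 => loc.
have [lt_a fe] := located_fetch loc.
have loc1 : located P a.+1 l.
  by apply: (@located_catl _ _ _ [:: IJz 0 a a]); rewrite -addn1;
     apply: (@located_catr _ _ [:: _]) loc.
have loc2 : located P (a.+1 + size l) [:: IJz 0 a a].
  by apply: located_catr; rewrite -addn1; apply: (@located_catr _ _ [:: _]) loc.
have [lt_b fb] := located_fetch loc2.
suff H k : k <= n -> star P B x (a, (st k).1, (st k).2)
    (a + size (t (a + size l).+2 a.+1 :: l ++ [:: IJz 0 a a]), (st n).1, (st n).2).
  exact: H.
move=> le_kn; rewrite -(subKn le_kn); elim: (n - k) (leq_subr k n) => [|m IH] le_mn.
  rewrite subn0; have [g e] := ht (a + size l).+2 a.+1 (st n).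
  apply: starS; rewrite ?fe ?e ?(negbTE hn) //.
  by rewrite /= size_cat /= addn1 !addnS; apply: star0.
have lt : n - m.+1 < n by lia.
have [hcd tr] := hc _ lt.
have [g e] := ht (a + size l).+2 a.+1 (st (n - m.+1)).
apply: starS; rewrite ?fe ?e ?hcd //.
apply: star_trans (tr P _ loc1) _.
apply: starS; rewrite ?fb //= if_same.
have -> : (n - m.+1).+1 = n - m by lia.
by apply: IH; lia.
Qed.

Definition cinc r := cone (IInc r).
Definition cdec r := cone (IDec r).
Definition cright := cone IRight.
Definition wreg r c := cwhile (IJz r) c.
Definition winp c := cwhile (fun e b => IInp e b b) c.
(** The initial step to the left takes the head off the right marker, which the loop could not tell
    from the left one. *)
Definition crew := cseq (cone ILeft) (winp (cone ILeft)).
Definition cmove a b := wreg a (cseq (cdec a) (cinc b)).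
Definition cclear a := wreg a (cdec a).
(** The three targets fall through two, one or no increments, which yields the values of [icode]. *)
Definition cread f : code :=
  fun a => [:: IInp a.+3 a.+2 a.+1; IInc f a.+2; IInc f a.+3].

Ltac store_ext :=
  apply: functional_extensionality => ?; rewrite /upd;
  repeat (case: eqP => ?; subst); subst => //=; try lia.

Lemma triple_inc x B r s s' h : s r < B -> s' = upd s r (s r).+1 ->
  triple x B (cinc r) (s, h) (s', h).
Proof. by move=> lt ->; apply: triple_one. Qed.

Lemma triple_dec x B r s s' h : 0 < s r -> s' = upd s r (s r).-1 ->
  triple x B (cdec r) (s, h) (s', h).
Proof. by move=> lt ->; apply: triple_one. Qed.

Lemma triple_right x B s h h' : h' = minn h.+1 (size x).+1 ->
  triple x B cright (s, h) (s, h').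
Proof. by move=> ->; apply: triple_one. Qed.

Lemma triple_wreg x B r c (st : nat -> store * nat) n :
  (forall k, k < n -> 0 < (st k).1 r /\ triple x B c (st k) (st k.+1)) ->
  (st n).1 r = 0 -> triple x B (wreg r c) (st 0) (st n).
Proof.
move=> hk hn; apply: (@triple_while _ _ _ (fun st => 0 < st.1 r)).
- by move=> e b [s h] /=; split=> //; rewrite lt0n; case: eqP.
- exact: hk.
by rewrite hn.
Qed.

Lemma triple_winp x B c (st : nat -> store * nat) n :
  (forall k, k < n -> isSome (read_input x (st k).2) /\ triple x B c (st k) (st k.+1)) ->
  read_input x (st n).2 = None -> triple x B (winp c) (st 0) (st n).
Proof.
move=> hk hn; apply: (@triple_while _ _ _ (fun st => isSome (read_input x st.2))).
- by move=> e b [s h] /=; split=> //; case: (read_input _ _) => // -[].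
- exact: hk.
by rewrite hn.
Qed.

Lemma triple_eq x B c st1 st2 st1' st2' :
  st1 = st1' -> st2 = st2' -> triple x B c st1 st2 -> triple x B c st1' st2'.
Proof. by move=> -> ->. Qed.

Lemma triple_crew x B s h : h <= (size x).+1 ->
  triple x B crew (s, h) (s, 0).
Proof.
move=> le_h; apply: triple_seq (s, h.-1) _ _ _; first exact: triple_one.
apply: (@triple_eq _ _ _ (s, h.-1 - 0) (s, h.-1 - h.-1)).
- by rewrite subn0.
- by rewrite subnn.
apply: (@triple_winp _ _ _ (fun k => (s, h.-1 - k))); last by rewrite subnn.
move=> k lt; split; last by apply: triple_one => m; split=> //=; rewrite subnS.
by rewrite /= /read_input ifT //; lia.
Qed.

Lemma triple_clear x B r s s' h : s' = upd s r 0 ->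
  triple x B (cclear r) (s, h) (s', h).
Proof.
move=> ->; apply: (@triple_eq _ _ _ (upd s r (s r - 0), h) (upd s r (s r - s r), h)).
- by congr pair; store_ext.
- by rewrite subnn.
apply: (@triple_wreg _ _ _ _ (fun k => (upd s r (s r - k), h))) => [k lt|] /=;
  rewrite /upd eqxx ?subnn //.
split; first lia.
apply: triple_dec; [by rewrite /= eqxx; lia | by store_ext].
Qed.

Lemma triple_move x B a b s s' h : a != b -> s a + s b <= B ->
  s' = upd (upd s a 0) b (s b + s a) -> triple x B (cmove a b) (s, h) (s', h).
Proof.
move=> ab le ->.
pose st k : store * nat := (upd (upd s a (s a - k)) b (s b + k), h).
apply: (@triple_eq _ _ _ (st 0) (st (s a))).
- by congr pair; store_ext.
- by congr pair; store_ext.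
apply: triple_wreg => [k lt|] /=; last by rewrite /upd (negbTE ab) eqxx subnn.
split; first by rewrite /upd (negbTE ab) eqxx; lia.
apply: triple_seq (upd (upd s a (s a - k).-1) b (s b + k), h) _ _ _.
  by apply: triple_dec; [rewrite /upd (negbTE ab) eqxx; lia | store_ext].
by apply: triple_inc; [rewrite /upd eqxx; lia | store_ext].
Qed.

Definition icode (o : option bool) : nat :=
  if o is Some b then b.+1 else 0.

Lemma triple_read x B f s s' h : s f = 0 -> 2 <= B ->
  s' = upd s f (icode (read_input x h)) ->
  triple x B (cread f) (s, h) (s', h).
Proof.
move=> s0 B2 -> P a; rewrite /cread => loc.
have [lt1 f1] := located_fetch loc.
have := @located_catr _ _ [:: _] _ loc; rewrite addn1 => loc2.
have [lt2 f2] := located_fetch loc2.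
have := @located_catr _ _ [:: _] _ loc2; rewrite addn1 => loc3.
have [lt3 f3] := located_fetch loc3.
apply: starS; rewrite ?f1 //= addn3.
have last_inc s1 : s1 f < B ->
    star P B x (a.+2, s1, h) (a.+3, upd s1 f (s1 f).+1, h).
  by move=> lt; apply: starS; rewrite ?f3 //; apply: star0.
rewrite /=; case: (read_input x h) => [[]|] /=.
- apply: starS; rewrite ?f2 //=; first by rewrite s0; lia.
  have := @last_inc (upd s f (s f).+1).
  rewrite {1 3}/upd eqxx s0 => /(_ B2).
  by congr star; congr (_, _, _); store_ext.
- by have := last_inc s; rewrite s0; apply; lia.
have -> : upd s f 0 = s by store_ext.
exact: star0.
Qed.

(** The head stops at the right marker, and positions beyond the input read as end markers, so
    moving right [a] times reads the symbol at [a] even when [a] is too large. *)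
Lemma read_input_min x a : read_input x (minn a (size x).+1) = read_input x a.
Proof.
rewrite /read_input; case: (leqP a (size x).+1) => // h.
by rewrite ltnn andbF; case: ifP => //; lia.
Qed.

(** * Bounded primitive recursion on the length and the bits of the input *)

(** Variables are indices into an environment, with default value 0; [ERec] pushes the counter and
    the accumulator. [EDel] and [ETake] evaluate in a shortened environment, which makes weakening
    possible without renaming variables inside expressions. *)
Inductive expr :=
| EVar (i : nat) | EZero | ESucc (e : expr) | ELen | EInp (e : expr)
| ELet (e1 e2 : expr) | ERec (en e0 es : expr)
| EDel (m n : nat) (e : expr) | ETake (n : nat) (e : expr).

Definition prec (b : nat) (f : nat -> nat -> nat) (n : nat) : nat :=
  nat_rect (fun _ => nat) b f n.

Fixpoint den (x : seq bool) (e : expr) (v : seq nat) : nat :=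
  match e with
  | EVar i => nth 0 v i
  | EZero => 0
  | ESucc e => (den x e v).+1
  | ELen => size x
  | EInp e => icode (read_input x (den x e v))
  | ELet e1 e2 => den x e2 (den x e1 v :: v)
  | ERec en e0 es =>
      prec (den x e0 v) (fun k a => den x es [:: k, a & v]) (den x en v)
  | EDel m n e => den x e (take m v ++ drop n v)
  | ETake n e => den x e (take n v)
  end.

(* every value occurring during the evaluation is at most B *)
Fixpoint bd (B : nat) (x : seq bool) (e : expr) (v : seq nat) : Prop :=
  match e with
  | EVar i => nth 0 v i <= B
  | EZero => True
  | ESucc e => bd B x e v /\ den x e v < B
  | ELen => size x <= B
  | EInp e => bd B x e v /\ 2 <= B
  | ELet e1 e2 => bd B x e1 v /\ bd B x e2 (den x e1 v :: v)
  | ERec en e0 es => [/\ bd B x en v, bd B x e0 v &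
      forall k, k < den x en v ->
        bd B x es [:: k, prec (den x e0 v) (fun k a => den x es [:: k, a & v]) k & v]]
  | EDel m n e => bd B x e (take m v ++ drop n v)
  | ETake n e => bd B x e (take n v)
  end.

Lemma bd_den B x e v : bd B x e v -> den x e v <= B.
Proof.
elim: e v => /= [i v //|v //|e IH v [h1 h2] //|v //|e IH v [h1 h2]|e1 IH1 e2 IH2 v [h1 h2]|
                  en IHn e0 IH0 es IHs v [h1 h2 h3]|m n e IH v|n e IH v].
- by case: read_input => // -[] //=; lia.
- exact: IH2.
- by case: (den x en v) h3 => [|n] h3 /=; [exact: IH0 | apply: IHs; apply: h3].
- exact: IH.
- exact: IH.
Qed.

Lemma bd_le B B' x e v : B <= B' -> bd B x e v -> bd B' x e v.
Proof.
move=> le; elim: e v => /= [i v|v //|e IH v [h1 h2]|v|e IH v [h1 h2]|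
    e1 IH1 e2 IH2 v [h1 h2]|en IHn e0 IH0 es IHs v [h1 h2 h3]|m n e IH v|n e IH v].
- by move/leq_trans; apply.
- by split; [exact: IH | exact: leq_trans le].
- by move/leq_trans; apply.
- by split; [exact: IH | exact: leq_trans le].
- by split; [exact: IH1 | exact: IH2].
- by split; [exact: IHn | exact: IH0 | move=> k /h3; exact: IHs].
- exact: IH.
- exact: IH.
Qed.

(* register 0 is never written: it provides the default value of variables *)
Fixpoint comp (e : expr) (rho : seq nat) (f : nat) : code :=
  match e with
  | EVar i => let r := nth 0 rho i in
      cseq (wreg r (cseq (cdec r) (cseq (cinc f) (cinc f.+1)))) (cmove f.+1 r)
  | EZero => cskip
  | ESucc e => cseq (comp e rho f) (cinc f)
  | ELen => cseq cright (cseq (winp (cseq (cinc f) cright)) crew)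
  | EInp e => cseq (comp e rho f)
      (cseq (wreg f (cseq (cdec f) cright)) (cseq (cread f) crew))
  | ELet e1 e2 => cseq (comp e1 rho f) (cseq (comp e2 (f :: rho) f.+1)
      (cseq (cclear f) (cmove f.+1 f)))
  | ERec en e0 es => cseq (comp en rho f) (cseq (comp e0 rho f.+2)
      (cseq (wreg f (cseq (cdec f) (cseq (comp es [:: f.+1, f.+2 & rho] f.+3)
         (cseq (cclear f.+2) (cseq (cmove f.+3 f.+2) (cinc f.+1))))))
      (cseq (cclear f.+1) (cmove f.+2 f))))
  | EDel m n e => comp e (take m rho ++ drop n rho) f
  | ETake n e => comp e (take n rho) f
  end.

(** * Correctness of the compiled programs *)

Lemma nth_map_store (s : store) rho i : s 0 = 0 ->
  nth 0 (map s rho) i = s (nth 0 rho i).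
Proof.
move=> s0; case: (ltnP i (size rho)) => h; first exact: nth_map.
by rewrite !nth_default ?size_map.
Qed.

Lemma nth_reg_lt rho f i : 0 < f -> all (fun r => r < f) rho -> nth 0 rho i < f.
Proof.
move=> f0 /allP h; case: (ltnP i (size rho)) => hi; first by apply/h/mem_nth.
by rewrite nth_default.
Qed.

Lemma map_upd_out (s : store) rho f g v : all (fun r => r < f) rho -> f <= g ->
  map (upd s g v) rho = map s rho.
Proof.
by move=> /allP h fg; apply/eq_in_map => r /h lt; rewrite /upd; case: eqP => //; lia.
Qed.

(** A counter is read by emptying it: [r] is drained into [f] and [f.+1] at once, and [f.+1] is then
    moved back to [r]. *)
Lemma triple_copy x B r f s s' h : r < f -> s f = 0 -> s f.+1 = 0 -> s r <= B ->
  s' = upd s f (s r) ->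
  triple x B (cseq (wreg r (cseq (cdec r) (cseq (cinc f) (cinc f.+1))))
                   (cmove f.+1 r)) (s, h) (s', h).
Proof.
move=> rf s0 s1 le ->.
pose st k : store * nat := (upd (upd (upd s r (s r - k)) f k) f.+1 k, h).
apply: (@triple_eq _ _ _ (st 0) (upd s f (s r), h)) => //.
  by congr pair; store_ext.
apply: triple_seq (st (s r)) _ _ _.
  apply: triple_wreg => [k lt|] /=; last by rewrite /upd; repeat case: eqP => ?; lia.
  split; first by rewrite /upd; repeat case: eqP => //; lia.
  apply: triple_seq (upd (upd (upd s r (s r - k.+1)) f k) f.+1 k, h) _ _ _.
    by apply: triple_dec; [rewrite /upd; repeat case: eqP => ?; lia | store_ext].
  apply: triple_seq (upd (upd (upd s r (s r - k.+1)) f k.+1) f.+1 k, h) _ _ _.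
    by apply: triple_inc; [rewrite /upd; repeat case: eqP => ?; lia | store_ext].
  by apply: triple_inc; [rewrite /upd; repeat case: eqP => ?; lia | store_ext].
apply: triple_move; first lia.
  by rewrite /upd; repeat case: eqP => ?; lia.
by store_ext.
Qed.

Ltac upd_lia := rewrite /upd; repeat case: eqP => ?; lia.

(** All registers from [f] on are empty and the input head is at the left marker when a fragment
    starts, and again when it ends, except for the result in [f]. The clearings that end the code of
    [ELet] and [ERec] restore this condition. *)
Lemma triple_comp x B e rho f s : s 0 = 0 -> 0 < f -> all (fun r => r < f) rho ->
  (forall r, f <= r -> s r = 0) -> bd B x e (map s rho) ->
  triple x B (comp e rho f) (s, 0) (upd s f (den x e (map s rho)), 0).
Proof.
elim: e rho f s => [i | | e IH | | e IH | e1 IH1 e2 IH2 | en IHn e0 IH0 es IHs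
  | m n e IH | n e IH] rho f s s0 f0 hrho hs.
- rewrite /= nth_map_store // => le.
  by apply: triple_copy => //; [exact: nth_reg_lt | exact: hs | exact: hs].
- move=> _; apply: (@triple_eq _ _ _ (s, 0) (s, 0)) => //; last exact: triple_skip.
  by congr pair; store_ext; rewrite hs.
- move=> [h1 h2]; apply: triple_seq (IH _ _ _ s0 f0 hrho hs h1) _.
  by apply: triple_inc; [rewrite /upd eqxx | store_ext].
- move=> /= le; apply: triple_seq (s, 1) _ _ _; first by apply: triple_right; lia.
  apply: triple_seq (upd s f (size x), (size x).+1) _ _ _; last exact: triple_crew.
  pose st k : store * nat := (upd s f k, k.+1).
  apply: (@triple_eq _ _ _ (st 0) (st (size x))) => //.
    by congr pair; store_ext; rewrite hs.
  apply: triple_winp => [k lt | ] /=; last first.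
    by rewrite /read_input ltnn andbF.
  split; first by rewrite /read_input ifT //; lia.
  apply: triple_seq (upd s f k.+1, k.+1) _ _ _.
    by apply: triple_inc; [upd_lia | store_ext].
  by apply: triple_right; lia.
- move=> [h1 h2]; apply: triple_seq (IH _ _ _ s0 f0 hrho hs h1) _ => /=.
  have := bd_den h1; set a := den _ _ _ => le_a.
  pose st k : store * nat := (upd s f (a - k), minn k (size x).+1).
  apply: triple_seq (st a) _ _ _.
    apply: (@triple_eq _ _ _ (st 0) (st a)) => //.
      by rewrite /st subn0 min0n.
    apply: triple_wreg => [k lt | ] /=; last by upd_lia.
    split; first by upd_lia.
    apply: triple_seq (upd s f (a - k.+1), minn k (size x).+1) _ _ _.
      by apply: triple_dec; [upd_lia | store_ext].
    by apply: triple_right; lia.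
  apply: triple_seq (upd s f (icode (read_input x a)), minn a (size x).+1) _ _ _.
    by apply: triple_read => //; [upd_lia | rewrite read_input_min; store_ext].
  by apply: triple_crew; lia.
- move=> [h1 h2]; apply: triple_seq (IH1 _ _ _ s0 f0 hrho hs h1) _ => /=.
  move: h2 (bd_den h1); set a := den x e1 _ => h2 le_a.
  have em : map (upd s f a) (f :: rho) = a :: map s rho.
    by rewrite /= (map_upd_out _ _ hrho) // /upd eqxx.
  apply: triple_seq.
    apply: IH2; rewrite ?em //.
    - by upd_lia.
    - by rewrite /= leqnn; apply: sub_all hrho => r; lia.
    by move=> r le; rewrite /upd; case: eqP => ?; [lia | apply: hs; lia].
  rewrite em; move: (bd_den h2); set b := den _ _ _ => le_b.
  apply: triple_seq; first (apply: triple_clear; exact: erefl).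
  by apply: triple_move; [lia | upd_lia | store_ext; rewrite hs].
- move=> [h1 h2 h3]; apply: triple_seq (IHn _ _ _ s0 f0 hrho hs h1) _ => /=.
  move: h3 (bd_den h1); set v := map s rho; set n := den x en v.
  set F := prec _ _ => h3 le_n.
  have F_le k : k <= n -> F k <= B.
    by case: k => [_ | k lt]; [exact: bd_den h2 | exact: bd_den (h3 k lt)].
  (* After [k] rounds [f] holds the number of rounds left, [f.+1] the counter and [f.+2] the
     accumulator. *)
  pose st k : store * nat := (upd (upd (upd s f (n - k)) f.+1 k) f.+2 (F k), 0).
  apply: triple_seq (st 0) _ _ _.
    have em : map (upd s f n) rho = v by rewrite (map_upd_out _ _ hrho).
    apply: (@triple_eq _ _ _ (upd s f n, 0) (upd (upd s f n) f.+2 (F 0), 0)) => //.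
      by congr pair; store_ext; rewrite hs.
    rewrite -[F 0]/(den x e0 v) -em; apply: IH0; rewrite ?em //.
    - by upd_lia.
    - by apply: sub_all hrho => r; lia.
    by move=> r le; rewrite /upd; case: eqP => ?; [lia | apply: hs; lia].
  apply: triple_seq (st n) _ _ _; last first.
    apply: triple_seq (upd (st n).1 f.+1 0, 0) _ _ _; first exact: triple_clear.
    apply: triple_move; first by lia.
      by rewrite /st /=; have := F_le n (leqnn n); upd_lia.
    rewrite /st /=; store_ext; rewrite hs //; lia.
  apply: triple_wreg => [k lt | ] /=; last by upd_lia.
  split; first by upd_lia.
  pose S1 := upd (upd (upd s f (n - k.+1)) f.+1 k) f.+2 (F k).
  apply: triple_seq (S1, 0) _ _ _.
    by rewrite /st /S1; apply: triple_dec; [upd_lia | store_ext].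
  have em : map S1 [:: f.+1, f.+2 & rho] = [:: k, F k & v].
    rewrite /= /S1; congr [:: _, _ & _]; try upd_lia.
    by rewrite !(map_upd_out _ _ hrho) //; lia.
  apply: triple_seq (upd S1 f.+3 (F k.+1), 0) _ _ _.
    have -> : F k.+1 = den x es (map S1 [:: f.+1, f.+2 & rho]) by rewrite em.
    apply: IHs; rewrite ?em //.
    - by rewrite /S1; upd_lia.
    - by rewrite /= !ltnS leqnn leqnSn /=; apply: sub_all hrho => r; lia.
    - by move=> r le; rewrite /S1 /upd; do 3 (case: eqP => ?; first lia); apply: hs; lia.
    exact: h3.
  have := F_le _ lt; set b := F k.+1 => le_b.
  apply: triple_seq; first (apply: triple_clear; exact: erefl).
  apply: triple_seq (upd (upd (upd s f (n - k.+1)) f.+1 k) f.+2 b, 0) _ _ _.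
    apply: triple_move; [lia | rewrite /S1; upd_lia | rewrite /S1; store_ext].
    by rewrite hs //; lia.
  by apply: triple_inc; [upd_lia | store_ext].
- move=> h /=; rewrite -map_drop -map_take -map_cat.
  apply: IH; rewrite ?map_cat ?map_drop ?map_take //.
  apply/allP => r; rewrite mem_cat => /orP[/mem_take | /mem_drop];
  by move/allP: hrho; apply.
move=> h /=; rewrite -map_take; apply: IH; rewrite ?map_take //.
by apply/allP => r /mem_take; move/allP: hrho; apply.
Qed.

(** * Turing machines for counter programs *)

Section DetMachine.
Variables (Q : finType) (q0 : Q) (hlt acc : Q -> bool).
Variable delta : Q -> option bool -> bool -> Q * bool * Dir * Dir.

Definition dtm : NTM := {|
  tm_ns := #|Q|;
  tm_delta := fun q a b =>
    let: (q', w, di, dw) := delta (enum_val q) a b in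
    [:: (enum_rank q', w, di, dw)];
  tm_start := enum_rank q0;
  tm_halt := fun q => hlt (enum_val q);
  tm_acc := fun q => acc (enum_val q) |}.

Definition dconf := (Q * nat * (nat -> bool) * nat)%type.

Definition dstep (x : seq bool) (c : dconf) : dconf :=
  let: (q, i, w, j) := c in
  let: (q', b, di, dw) := delta q (read_input x i) (w j) in
  (q', move_in x di i, (fun k => if k == j then b else w k), move_work dw j).

Inductive drun (x : seq bool) (s : nat) : dconf -> dconf -> Prop :=
| drun0 c : drun x s c c
| drunS q i w j c : ~~ hlt q -> j <= s ->
    drun x s (dstep x (q, i, w, j)) c -> drun x s (q, i, w, j) c.

Lemma drun_trans x s c1 c2 c3 :
  drun x s c1 c2 -> drun x s c2 c3 -> drun x s c1 c3.
Proof. by elim=> // q i w j c h1 h2 _ IH /IH; apply: (drunS h1 h2). Qed.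

Definition demb (c : dconf) : config dtm :=
  let: (q, i, w, j) := c in (enum_rank q, i, w, j).

Lemma deterministic_dtm : deterministic dtm.
Proof. by move=> q a b /=; case: (delta _ a b) => [[[? ?] ?] ?]. Qed.

Lemma drun_good x s c q i w j : drun x s c (q, i, w, j) -> hlt q -> j <= s ->
  exists fuel, good x s fuel (demb c) /\ acc_paths x fuel (demb c) = acc q.
Proof.
move=> + hq js; move E: (q, i, w, j) => c' run.
elim: run E => {c c'} [c <- | q' i' w' j' c nh le _ IH /IH [fuel [hg ha]]].
  by exists 0; rewrite /= enum_rankK hq; split=> //; split=> //; left.
exists fuel.+1; rewrite /= enum_rankK (negbTE nh) /=; move: hg ha.
rewrite /dstep; case: (delta _ _ _) => [[[q1 b1] di] dw] /= hg ha.
split; last by rewrite addn0.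
by split=> //; right=> c2 /= [<-|].
Qed.

End DetMachine.

(** * Counter programs on a binary work tape *)

Section CounterMachine.
Variables (P : seq instr) (R : nat).

Definition reg_ok (i : instr) : bool :=
  match i with
  | IInc r _ | IDec r _ | IJz r _ _ => r < R
  | _ => true
  end.

(* A block consists of R.+2 cells: the first one marks block 0, the second one
   marks the blocks already in use, and the p-th block stores the p-th binary
   digits of the registers. *)
Definition cell (s : store) (H p o : nat) : bool :=
  if o == 0 then p == 0 else if o == 1 then p < H else bit (s o.-2) p.

Definition layout (s : store) (H k : nat) : bool :=
  cell s H (k %/ R.+2) (k %% R.+2).

(* One sweep from the left end performs an instruction on a register: [act]
   gives the bit written at offset o and, when the sweep ends, the flag with
   which the head goes back to the left end. *)
Definition act (i : instr) (o : nat) (b : bool) : bool * option bool :=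
  match i with
  | IInc r _ => if o == 1 then (true, None)
      else if o == r.+2 then (~~ b, if b then None else Some false)
      else (b, None)
  | IDec r _ => if o == r.+2 then (~~ b, if b then Some false else None)
      else (b, None)
  | IJz r _ _ => if (o == 1) && ~~ b then (b, Some false)
      else if (o == r.+2) && b then (b, Some true) else (b, None)
  | _ => (b, None)
  end.

Definition target (i : instr) (fl : bool) : nat :=
  match i with
  | IInc _ n | IDec _ n => n
  | IJz _ lz ln => if fl then ln else lz
  | _ => 0
  end.

(** [None] is the initial state, which only marks block 0. In [Some (pc, d, o)], [d] is [None] while
    the head moves right and [Some fl] while it returns with the outcome [fl]; [o] is the head
    position modulo the block length, the only part of the position that the finite control can
    hold. *)
Definition cstate_type : finType :=
  option ('I_(size P).+1 * option bool * 'I_R.+2).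

Definition home (pc : nat) : cstate_type := Some (inord pc, None, ord0).

Definition cdelta (q : cstate_type) (a : option bool) (b : bool) :
  cstate_type * bool * Dir * Dir :=
  match q with
  | None => (home 0, true, Stay, Stay)
  | Some (pc, Some fl, o) =>
      if o == 0 :> nat then
        if b then (home (target (fetch P pc) fl), b, Stay, Stay)
        else (Some (pc, Some fl, inord R.+1), b, Stay, Lft)
      else (Some (pc, Some fl, inord o.-1), b, Stay, Lft)
  | Some (pc, None, o) =>
      match fetch P pc with
      | ILeft n => (home n, b, Lft, Stay)
      | IRight n => (home n, b, Rgt, Stay)
      | IInp lN l0 l1 =>
          (home (if a is Some c then (if c then l1 else l0) else lN), b, Stay, Stay)
      | i => match act i o b with
             | (b', None) => (Some (pc, None, inord (o.+1 %% R.+2)), b', Stay, Rgt)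
             | (b', Some fl) => (Some (pc, Some fl, inord o.-1), b', Stay, Lft)
             end
      end
  end.

Definition chlt (q : cstate_type) : bool :=
  if q is Some (pc, None, o) then if fetch P pc is IHalt _ then true else false
  else false.
Definition cacc (q : cstate_type) : bool :=
  if q is Some (pc, None, o) then if fetch P pc is IHalt b then b else false
  else false.

Notation run := (drun chlt cdelta).

Definition is_sweep (i : instr) : bool :=
  match i with IInc _ _ | IDec _ _ | IJz _ _ _ => true | _ => false end.

Lemma modnS_lt k W : (k %% W).+1 %% W = k.+1 %% W.
Proof. by rewrite -addn1 modnDml addn1. Qed.

Lemma modn_pred k W : 0 < k %% W -> (k %% W).-1 = k.-1 %% W.
Proof.
case: k => [|k]; first by rewrite mod0n.
case: W => [|W]; first by rewrite !modn0.
rewrite /= -modnS_lt; have := ltn_pmod k (ltn0Sn W).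
rewrite leq_eqVlt => /orP[/eqP -> | lt _]; first by rewrite modnn.
by rewrite (modn_small lt).
Qed.

Lemma val_pc pc : pc < size P -> (inord pc : 'I_(size P).+1) = pc :> nat.
Proof. by move=> lt; rewrite inordK // ltnW. Qed.

Lemma val_offset k : (inord (k %% R.+2) : 'I_R.+2) = k %% R.+2 :> nat.
Proof. by rewrite inordK // ltn_pmod. Qed.

Lemma cdelta_sweep pc k a b : pc < size P -> is_sweep (fetch P pc) ->
  cdelta (Some (inord pc, None, inord (k %% R.+2))) a b =
  match act (fetch P pc) (k %% R.+2) b with
  | (b', None) => (Some (inord pc, None, inord (k.+1 %% R.+2)), b', Stay, Rgt)
  | (b', Some fl) => (Some (inord pc, Some fl, inord (k %% R.+2).-1), b', Stay, Lft)
  end.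
Proof.
move=> lt sw; rewrite /cdelta val_pc // val_offset modnS_lt.
by case: (fetch P pc) sw.
Qed.

Lemma cdelta_back pc fl k a b : pc < size P ->
  cdelta (Some (inord pc, Some fl, inord (k %% R.+2))) a b =
  if k %% R.+2 == 0 then
    if b then (home (target (fetch P pc) fl), b, Stay, Stay)
    else (Some (inord pc, Some fl, inord R.+1), b, Stay, Lft)
  else (Some (inord pc, Some fl, inord (k %% R.+2).-1), b, Stay, Lft).
Proof. by move=> lt; rewrite /cdelta val_pc // val_offset. Qed.

Lemma sweep_right pc x S h w w' J fl :
  let i := fetch P pc in pc < size P -> is_sweep i ->
  (forall k, k < J -> act i (k %% R.+2) (w k) = (w' k, None)) ->
  act i (J %% R.+2) (w J) = (w' J, Some fl) -> J <= S -> 0 < J %% R.+2 ->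
  run x S (home pc, h, w, 0) (Some (inord pc, Some fl, inord (J.-1 %% R.+2)), h,
     (fun k => if k <= J then w' k else w k), J.-1).
Proof.
move=> i lt sw hw hJ JS J0.
have nh (o : 'I_R.+2) : ~~ chlt (Some (inord pc, None, o)).
  by move: sw; rewrite /chlt val_pc // -/i; case: i {hw hJ}.
suff H k : k <= J -> run x S
   (Some (inord pc, None, inord (k %% R.+2)), h,
     (fun k' => if k' < k then w' k' else w k'), k)
   (Some (inord pc, Some fl, inord (J.-1 %% R.+2)), h,
     (fun k => if k <= J then w' k else w k), J.-1).
  have := H 0 (leq0n _); congr (run _ _ (Some (_, _, _), _, _, _) _).
  by apply: val_inj; rewrite /= val_offset mod0n.
move=> le; rewrite -(subKn le); elim: (J - k) (leq_subr k J) => [|m IH] lem.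
  rewrite subn0; apply: drunS => //.
  rewrite /dstep cdelta_sweep // ltnn hJ modn_pred //=.
  have -> : (fun k0 => if k0 == J then w' J else if k0 < J then w' k0 else w k0)
    = (fun k0 => if k0 <= J then w' k0 else w k0).
    by apply: functional_extensionality => k0; case: ltngtP => // ->.
  exact: drun0.
have := IH (ltnW lem); have -> : J - m = (J - m.+1).+1 by lia.
set j := J - m.+1 => {}IH; have lt_j : j < J by lia.
apply: drunS => //; first by lia.
rewrite /dstep cdelta_sweep // ltnn hw //=.
have -> // : (fun k0 => if k0 == j then w' j else if k0 < j then w' k0 else w k0)
    = (fun k0 => if k0 < j.+1 then w' k0 else w k0).
by apply: functional_extensionality => k0; rewrite ltnS; case: ltngtP => // ->.
Qed.

(** Cell 0 is the only marked cell at offset 0, which is how the returning head recognises the left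
    end of the tape. *)
Lemma sweep_left pc x S h (w : nat -> bool) fl j : pc < size P -> w 0 ->
  (forall k, 0 < k -> k %% R.+2 = 0 -> ~~ w k) -> j <= S ->
  run x S (Some (inord pc, Some fl, inord (j %% R.+2)), h, w, j)
    (home (target (fetch P pc) fl), h, w, 0).
Proof.
move=> lt w0 hw; have id k b : w k = b -> (fun k0 => if k0 == k then b else w k0) = w.
  by move=> <-; apply: functional_extensionality => k0; case: eqP => // ->.
elim: j => [|j IH] le; apply: drunS => //; rewrite /dstep cdelta_back //.
  by rewrite mod0n /= w0 id //; apply: drun0.
case: eqP => [e0 | /eqP n0]; last first.
  by rewrite id //= modn_pred ?lt0n //=; apply: IH; lia.
rewrite (negbTE (hw _ _ e0)) //= id ?(negbTE (hw _ _ e0)) //.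
have -> : (inord R.+1 : 'I_R.+2) = inord (j %% R.+2); last by apply: IH; lia.
congr inord; move: e0; rewrite -modnS_lt; have := ltn_pmod j (ltn0Sn R.+1).
by rewrite leq_eqVlt => /orP[/eqP [->] // | lt']; rewrite modn_small.
Qed.

Lemma layout_nomark s H k : 0 < k -> k %% R.+2 = 0 -> ~~ layout s H k.
Proof.
move=> k0 e; rewrite /layout e /cell /=; move: k0; rewrite {1}(divn_eq k R.+2) e addn0.
by case: (k %/ R.+2).
Qed.

Lemma sweep_layout pc x S h w s' H' J fl :
  let i := fetch P pc in pc < size P -> is_sweep i ->
  (forall k, k < J -> act i (k %% R.+2) (w k) = (layout s' H' k, None)) ->
  act i (J %% R.+2) (w J) = (layout s' H' J, Some fl) ->
  (forall k, J < k -> w k = layout s' H' k) -> J <= S -> 0 < J %% R.+2 ->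
  run x S (home pc, h, w, 0) (home (target i fl), h, layout s' H', 0).
Proof.
move=> i lt sw hw hJ hr JS J0.
have right := @sweep_right pc x S h w _ J fl lt sw hw hJ JS J0.
apply: drun_trans right _.
have -> : (fun k => if k <= J then layout s' H' k else w k) = layout s' H'.
  by apply: functional_extensionality => k; case: leqP => // /hr.
apply: sweep_left => //; [exact: layout_nomark | lia].
Qed.

Lemma lex_lt W p o p0 o0 : o < W -> o0 < W ->
  (p * W + o < p0 * W + o0) = (p < p0) || (p == p0) && (o < o0).
Proof.
move=> lo lo0; case: (ltngtP p p0) => [lt | lt | ->] /=; last by rewrite ltn_add2l.
- by have := leq_mul lt (leqnn W); rewrite mulSn; lia.
by have := leq_mul lt (leqnn W); rewrite mulSn; lia.
Qed.

Lemma sweep pc x S h s H s' H' p0 o0 fl :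
  let i := fetch P pc in pc < size P -> is_sweep i -> 0 < o0 < R.+2 ->
  (forall p o, (p < p0) || (p == p0) && (o < o0) ->
     act i o (cell s H p o) = (cell s' H' p o, None)) ->
  act i o0 (cell s H p0 o0) = (cell s' H' p0 o0, Some fl) ->
  (forall p o, (p0 < p) || (p0 == p) && (o0 < o) -> cell s H p o = cell s' H' p o) ->
  p0.+1 * R.+2 <= S ->
  run x S (home pc, h, layout s H, 0) (home (target i fl), h, layout s' H', 0).
Proof.
move=> i lt sw /andP[o1 o2] hw hJ hr JS.
have em : (p0 * R.+2 + o0) %% R.+2 = o0 by rewrite modnMDl modn_small.
have ed : (p0 * R.+2 + o0) %/ R.+2 = p0 by rewrite divnMDl // divn_small // addn0.
apply: (@sweep_layout _ _ _ _ _ _ _ (p0 * R.+2 + o0)); rewrite ?em //.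
- by move=> k; rewrite {1}(divn_eq k R.+2) lex_lt ?ltn_pmod //; apply: hw.
- by rewrite /layout em ed.
- by move=> k; rewrite {1}(divn_eq k R.+2) lex_lt ?ltn_pmod //; apply: hr.
by rewrite mulSn in JS; lia.
Qed.

(** All digits 1 lie in the first [H] blocks, so a test for zero may give up at the first unmarked
    block. *)
Definition used (s : store) (H : nat) : Prop :=
  forall r k, r < R -> H <= k -> ~~ bit (s r) k.

Lemma cell_upd s H r v p o : o != r.+2 -> cell (upd s r v) H p o = cell s H p o.
Proof. by case: o => [|[|o]] //; rewrite /cell /upd /= !eqSS => /negbTE ->. Qed.

Lemma cell_reg s H r p : cell s H p r.+2 = bit (s r) p.
Proof. by []. Qed.

Section Step.
Variables (x : seq bool) (B L S : nat).
Hypotheses (BL : B < 2 ^ L) (LS : L.+1 * R.+2 <= S).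

(** Values up to [B] occupy [L] blocks; the additional one is where a test for zero meets the first
    unmarked block when all [L] are in use. *)
Lemma space_block p : p <= L -> p.+1 * R.+2 <= S.
Proof. by move=> h; apply: leq_trans LS; rewrite leq_mul2r ltnS h orbT. Qed.

Lemma block_lt p n : 2 ^ p <= n -> n <= B -> p < L.
Proof.
by move=> h1 h2; rewrite -(ltn_exp2l (m := 2)) //; lia.
Qed.

Lemma run_inc pc s h H r n : pc < size P -> fetch P pc = IInc r n -> r < R ->
  s r < B -> H <= L -> used s H ->
  exists H', [/\ H' <= L, used (upd s r (s r).+1) H' &
    run x S (home pc, h, layout s H, 0) (home n, h, layout (upd s r (s r).+1) H', 0)].
Proof.
move=> lt fe rR sB HL us.
have [p0 [b1 b2 b3 b4]] := bit_succ (s r).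
have p0L := block_lt b1 sB.
(* The sweep marks every block that it visits, up to the block [p0] in which the carry stops. *)
exists (maxn H p0.+1); split.
- by rewrite geq_max HL.
- move=> r' k r'R; rewrite geq_max => /andP[k1 k2].
  rewrite /upd; case: eqP => _; last exact: us.
  by rewrite b4 leqNgt k2 /=; apply: us.
have -> : n = target (fetch P pc) false by rewrite fe.
have er p H' : cell (upd s r (s r).+1) H' p r.+2 =
   if p <= p0 then ~~ bit (s r) p else bit (s r) p.
  by rewrite cell_reg /upd eqxx b4.
apply: (@sweep _ _ _ _ _ _ _ _ p0 r.+2); rewrite ?fe //.
- move=> p o po; have pp : p <= p0 by lia.
  rewrite /act; case: (o =P r.+2) po => [-> | /eqP o2] po /=.
    by rewrite er pp cell_reg b2 //; lia.
  rewrite (cell_upd _ _ _ _ o2); case: (o =P 1) => [-> | o1].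
    by rewrite /cell /= leq_max ltnS pp orbT.
  by rewrite /cell; case: o po o2 o1 => [|[|]].
- by rewrite er leqnn /act /= eqxx cell_reg (negbTE b3).
- move=> p o po; case: (o =P r.+2) po => [-> | /eqP o2] po /=.
    by rewrite er cell_reg ifN //; lia.
  rewrite (cell_upd _ _ _ _ o2) /cell; case: o po o2 => [|[|o]] po o2 //=; lia.
by apply: space_block; lia.
Qed.

Lemma run_dec pc s h H r n : pc < size P -> fetch P pc = IDec r n -> r < R ->
  0 < s r -> s r <= B -> H <= L -> used s H ->
  exists H', [/\ H' <= L, used (upd s r (s r).-1) H' &
    run x S (home pc, h, layout s H, 0) (home n, h, layout (upd s r (s r).-1) H', 0)].
Proof.
move=> lt fe rR s0 sB HL us.
have [p0 [b1 b2 b3 b4]] := bit_pred s0.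
have p0L := block_lt b1 sB.
have p0H : p0 < H by rewrite ltnNge; apply/negP => /(us _ _ rR); rewrite b3.
exists H; split=> //.
  move=> r' k r'R kH; rewrite /upd; case: eqP => _; last exact: us.
  by rewrite b4 ifN ?us //; lia.
have -> : n = target (fetch P pc) false by rewrite fe.
have er p H' : cell (upd s r (s r).-1) H' p r.+2 =
   if p <= p0 then ~~ bit (s r) p else bit (s r) p.
  by rewrite cell_reg /upd eqxx b4.
apply: (@sweep _ _ _ _ _ _ _ _ p0 r.+2); rewrite ?fe //.
- move=> p o po; have pp : p <= p0 by lia.
  rewrite /act; case: (o =P r.+2) po => [-> | /eqP o2] po /=.
    by rewrite er pp cell_reg (negbTE (b2 _ _)) //; lia.
  by rewrite (cell_upd _ _ _ _ o2).
- by rewrite er leqnn /act /= eqxx cell_reg b3.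
- move=> p o po; case: (o =P r.+2) po => [-> | /eqP o2] po /=.
    by rewrite er cell_reg ifN //; lia.
  by rewrite (cell_upd _ _ _ _ o2).
by apply: space_block; lia.
Qed.

Lemma run_jz pc s h H r lz ln : pc < size P -> fetch P pc = IJz r lz ln -> r < R ->
  H <= L -> used s H ->
  run x S (home pc, h, layout s H, 0)
    (home (if s r == 0 then lz else ln), h, layout s H, 0).
Proof.
move=> lt fe rR HL us.
have -> : (if s r == 0 then lz else ln) = target (fetch P pc) (s r != 0).
  by rewrite fe; case: eqP.
(* For the value 0 the sweep turns round at the mark cell of block [H]; otherwise at the lowest
   digit 1, which lies in a used block. *)
case: eqP => [s0 | /eqP]; last rewrite -lt0n => s0.
  apply: (@sweep _ _ _ _ _ _ _ _ H 1); rewrite ?fe //.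
  - move=> p o po; rewrite /act; case: (o =P 1) po => [-> | o1] po /=.
      by rewrite /cell /=; have -> : p < H by lia.
    by case: (o =P r.+2) => //= ->; rewrite cell_reg s0 bit0.
  - by rewrite /act /cell /= ltnn.
  exact: space_block.
have [p0 [b1 b2 b3 b4]] := bit_pred s0.
have p0H : p0 < H by rewrite ltnNge; apply/negP => /(us _ _ rR); rewrite b3.
apply: (@sweep _ _ _ _ _ _ _ _ p0 r.+2); rewrite ?fe //.
- move=> p o po; have pp : p <= p0 by lia.
  rewrite /act; case: (o =P r.+2) po => [-> | /eqP o2] po /=.
    by rewrite cell_reg (negbTE (b2 _ _)) //; lia.
  by case: (o =P 1) => //= ->; rewrite /cell /= (leq_ltn_trans pp p0H).
- by rewrite /act /= eqxx cell_reg b3.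
by apply: space_block; lia.
Qed.

Lemma run_star pc s h H pcf sf hf : all reg_ok P ->
  star P B x (pc, s, h) (pcf, sf, hf) -> pcf < size P ->
  H <= L -> used s H -> (forall r, r < R -> s r <= B) ->
  exists H', run x S (home pc, h, layout s H, 0) (home pcf, hf, layout sf H', 0).
Proof.
move=> ok + ltf; move E1: (pc, s, h) => c1; move E2: (pcf, sf, hf) => c2 st.
elim: st pc s h H E1 E2 => {c1 c2} [c | pc' s' h' c lt g _ IH] pc s h H.
  by move=> <- [-> -> ->] _ _ _; exists H; apply: drun0.
move=> [-> -> ->] E2 HL us sB.
have := all_nthP (IHalt false) ok _ lt; rewrite -/(fetch P pc').
have one q di : (forall b, cdelta (home pc') (read_input x h') b = (home q, b, di, Stay)) ->
    run x S (home pc', h', layout s' H, 0) (home q, move_in x di h', layout s' H, 0).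
  move=> e; apply: drunS => //.
    by rewrite /chlt /home val_pc //; case: (fetch _ _) g.
  rewrite /dstep e /=.
  have -> : (fun k => if k == 0 then layout s' H 0 else layout s' H k) = layout s' H.
    by apply: functional_extensionality => k; case: eqP => // ->.
  exact: drun0.
case fe: (fetch P pc') g IH one => [r n | r n | r lz ln | n | n | lN l0 l1 | b] //=
  g IH one rR.
- have [H' [H1 H2 H3]] := run_inc h' lt fe rR g HL us.
  have [|H'' run2] := IH _ _ _ H' erefl E2 H1 H2.
    by move=> r' r'R; rewrite /upd; case: eqP => // _; apply: sB.
  by exists H''; apply: drun_trans H3 run2.
- have [H' [H1 H2 H3]] := run_dec h' lt fe rR g (sB _ rR) HL us.
  have [|H'' run2] := IH _ _ _ H' erefl E2 H1 H2.
    by move=> r' r'R; rewrite /upd; case: eqP => _; [have := sB _ rR; lia | exact: sB].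
  by exists H''; apply: drun_trans H3 run2.
- have H3 := run_jz h' lt fe rR HL us.
  have [|H'' run2] := IH _ _ _ H erefl E2 HL us; first by [].
  by exists H''; apply: drun_trans H3 run2.
- have [|H'' run2] := IH _ _ _ H erefl E2 HL us; first by [].
  exists H''; apply: drun_trans run2; apply: (one _ Lft) => b.
  by rewrite /cdelta /home val_pc // fe.
- have [|H'' run2] := IH _ _ _ H erefl E2 HL us; first by [].
  exists H''; apply: drun_trans run2; apply: (one _ Rgt) => b.
  by rewrite /cdelta /home val_pc // fe.
have [|H'' run2] := IH _ _ _ H erefl E2 HL us; first by [].
exists H''; apply: drun_trans run2; apply: (one _ Stay) => b.
  by rewrite /cdelta /home val_pc // fe.
Qed.

End Step.
End CounterMachine.

(** * Logarithmic-space deciders from expressions *)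

Definition max_reg (P : seq instr) : nat :=
  foldr (fun i => maxn (if i is (IInc r _ | IDec r _ | IJz r _ _) then r.+1 else 0)) 0 P.

Lemma max_reg_ok P : all (reg_ok (max_reg P)) P.
Proof.
move: (leqnn (max_reg P)); move: {2 3}(max_reg P) => R.
elim: P => //= i P IH; rewrite geq_max => /andP[h /IH ->]; rewrite andbT.
by case: i h.
Qed.

Definition decider (e : expr) : seq instr :=
  let l := comp e [::] 1 0 in
  l ++ [:: IJz 1 (size l).+1 (size l).+2; IHalt false; IHalt true].

Definition decider_tm (e : expr) : NTM :=
  let P := decider e in
  dtm None (@chlt P (max_reg P)) (@cacc P (max_reg P)) (@cdelta P (max_reg P)).

Lemma decider_tmP e x B L S : bd B x e [::] -> B < 2 ^ L ->
  L.+1 * (max_reg (decider e)).+2 <= S ->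
  exists fuel, good x S fuel (init_config (decider_tm e)) /\
    acc_paths x fuel (init_config (decider_tm e)) = (den x e [::] != 0).
Proof.
set P := decider e; set R := max_reg P; move=> bde BL LS.
set l := comp e [::] 1 0.
have sP : size P = (size l).+3 by rewrite /P /decider size_cat addn3.
have loc : located P 0 l.
  by exists [::], [:: IJz 1 (size l).+1 (size l).+2; IHalt false; IHalt true].
have := @triple_comp x B e [::] 1 (fun=> 0) erefl isT isT (fun _ _ => erefl) bde P 0 loc.
rewrite add0n -/l /=; set a := den x e [::] => st1.
have f1 : fetch P (size l) = IJz 1 (size l).+1 (size l).+2.
  by rewrite /fetch nth_cat ltnn subnn.
pose pf := if a == 0 then (size l).+1 else (size l).+2.
have fp : fetch P pf = IHalt (a != 0).
  rewrite /fetch nth_cat /pf; case: eqP => _.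
    by rewrite ltnNge leqnSn /= subSnn.
  by rewrite -/l ltnNge ltnW //= -[in _ - _]addn2 addKn.
have lt_pf : pf < size P by rewrite sP /pf; case: eqP; lia.
have st : star P B x (0, (fun=> 0), 0) (pf, upd (fun=> 0) 1 a, 0).
  apply: star_trans st1 _; apply: starS; rewrite ?f1 ?sP //=; first by lia.
  by rewrite /upd eqxx; apply: star0.
have [||H run1] := run_star BL LS (max_reg_ok P) st lt_pf (leq0n L).
- by move=> r k _ _; rewrite bit0.
- by [].
(* The first step writes the mark of block 0, which turns the blank tape into the layout of the zero
   store with no block in use. *)
have run0 : drun (@chlt P R) (@cdelta P R) x S (None, 0, (fun=> false), 0)
    (home P R pf, 0, layout R (upd (fun=> 0) 1 a) H, 0).
  apply: drunS => //; rewrite /=.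
  have -> : (fun k : nat => if k == 0 then true else false) = layout R (fun=> 0) 0.
    apply: functional_extensionality => k; rewrite /layout /cell bit0 ltn0 if_same.
    rewrite {1}(divn_eq k R.+2) addn_eq0 muln_eq0 orbF andbC.
    by do 2 case: eqP.
  exact: run1.
have hl : @chlt P R (home P R pf) by rewrite /chlt /home val_pc // fp.
have [fuel [g h]] := drun_good None (@cacc P R) run0 hl (leq0n S).
exists fuel; split; first exact: g.
have -> : (a != 0) = @cacc P R (home P R pf) by rewrite /cacc /home val_pc // fp.
exact: h.
Qed.

Lemma trunc_log_pow n K : (n + 2) ^ K < 2 ^ ((trunc_log 2 n).+2 * K).+1.
Proof.
apply: (@leq_ltn_trans (2 ^ ((trunc_log 2 n).+2 * K))); last by rewrite ltn_exp2l.
rewrite expnM; case: K => // K; rewrite leq_exp2r //.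
by have := @trunc_log_ltn 2 n isT; rewrite !expnS; lia.
Qed.

Lemma in_L_decider (A : language) e K :
  (forall x, bd ((size x + 2) ^ K) x e [::] /\ (A x <-> den x e [::] != 0)) -> in_L A.
Proof.
(* With [t] the logarithm of the input length, [trunc_log_pow] allows [t.+2 * K + 1] digits; one
   more block gives at most [2 * K.+1 * t.+1] blocks, each of [(max_reg (decider e)).+2] cells. *)
move=> h; exists (decider_tm e), (2 * K.+1 * (max_reg (decider e)).+2).
split; first exact: deterministic_dtm.
move=> x; have [bde Ax] := h x.
have [|fuel [g ha]] := decider_tmP bde (trunc_log_pow (size x) K)
    (S := log_space (2 * K.+1 * (max_reg (decider e)).+2) x).
  rewrite /log_space [X in _ <= X]mulnAC; apply: leq_mul => //.
  by move: (trunc_log _ _) => t; nia.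
by exists fuel; split=> //; rewrite ha lt0b.
Qed.

(** * The class of polynomially bounded functions computable in logarithmic space *)

Definition fn := seq bool -> seq nat -> nat.

Definition pol (K : nat) (x : seq bool) (v : seq nat) : nat :=
  (size x + sumn v + 2) ^ K.

(** The bound is required for every environment and is polynomial in the arguments as well as in the
    input length; this uniformity makes the class closed under composition. *)
Definition LS (F : fn) : Prop :=
  exists e K, forall x v, den x e v = F x v /\ bd (pol K x v) x e v.

Lemma pol_le K K' x v : K <= K' -> pol K x v <= pol K' x v.
Proof. by move=> h; rewrite leq_pexp2l // addn2. Qed.

Lemma LS_ext F G : (forall x v, F x v = G x v) -> LS F -> LS G.
Proof. by move=> e [t [K h]]; exists t, K => x v; rewrite -e. Qed.

Lemma LS_pol F : LS F -> exists K, forall x v, F x v <= pol K x v.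
Proof. by case=> e [K h]; exists K => x v; have [<- /bd_den] := h x v. Qed.

Lemma nth_sumn v i : nth 0 v i <= sumn v.
Proof.
elim: v i => [|a v IH] [|i] //=; first by rewrite leq_addr.
exact: leq_trans (IH i) (leq_addl _ _).
Qed.

Lemma LS_var i : LS (fun _ v => nth 0 v i).
Proof.
exists (EVar i), 1 => x v; split=> //=; rewrite /pol expn1.
by have := nth_sumn v i; lia.
Qed.

Lemma LS_zero : LS (fun _ _ => 0).
Proof. by exists EZero, 0 => x v. Qed.

Lemma LS_size : LS (fun x _ => size x).
Proof. by exists ELen, 1 => x v; split=> //=; rewrite /pol expn1; lia. Qed.

Lemma pol_add K x v : (pol K x v).+1 <= pol K.+1 x v.
Proof.
rewrite /pol expnS; set b := _ + 2; have b2 : 2 <= b by rewrite /b addn2.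
have : 0 < b ^ K by rewrite expn_gt0 ltnW.
by move: (b ^ K) => A; nia.
Qed.

Lemma LS_succ F : LS F -> LS (fun x v => (F x v).+1).
Proof.
case=> e [K h]; exists (ESucc e), K.+1 => x v; have [<- b] := h x v.
split=> //=; split; first by apply: bd_le b; apply: pol_le.
by apply: leq_trans (pol_add K x v); rewrite ltnS; apply: bd_den.
Qed.

Lemma LS_inp F : LS F -> LS (fun x v => icode (read_input x (F x v))).
Proof.
case=> e [K h]; exists (EInp e), K.+1 => x v; have [<- b] := h x v.
split=> //=; split; first by apply: bd_le b; apply: pol_le.
apply: leq_trans (pol_le x v (isT : 1 <= K.+1)).
by rewrite /pol expn1 leq_addl.
Qed.


Lemma pol_comp x v v' K1 K2 : size x + sumn v' + 2 <= pol K1 x v ->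
  pol K2 x v' <= pol (K1 * K2) x v.
Proof. by move=> h; rewrite /pol expnM; case: K2 => // K2; rewrite leq_exp2r. Qed.

(** Let [c = size x + sumn v + 2]. The numbers [c], [a] and [b] are each at most [c ^ (K1 + K2).+1],
    and the factor [c ^ 2 >= 4] absorbs their sum. *)
Lemma pol_sum3 x v a b K1 K2 : a <= pol K1 x v -> b <= pol K2 x v ->
  size x + sumn [:: a, b & v] + 2 <= pol (K1 + K2).+3 x v.
Proof.
move=> ha hb.
have h1 : pol 1 x v <= pol (K1 + K2).+1 x v by apply: pol_le.
have h2 : pol K1 x v <= pol (K1 + K2).+1 x v by apply: pol_le; lia.
have h3 : pol K2 x v <= pol (K1 + K2).+1 x v by apply: pol_le; lia.
move: h1 h2 h3 ha hb; rewrite /pol expn1 (expnS _ _.+2) (expnS _ _.+1) /=.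
have -> : size x + (a + (b + sumn v)) + 2 = (size x + sumn v + 2) + a + b by lia.
move: (size x + sumn v + 2) (addn2 (size x + sumn v)) => c c2.
move: (c ^ _.+1) (c ^ K1) (c ^ K2) => A C D h1 h2 h3 ha hb.
have : 4 * A <= c * (c * A) by rewrite mulnA leq_mul2r c2; apply/orP; right; nia.
by lia.
Qed.

Lemma sumn_del m n v : m <= n -> sumn (take m v ++ drop n v) <= sumn v.
Proof.
move=> le; rewrite -{3}(cat_take_drop n v) !sumn_cat leq_add2r.
by rewrite -{1}(cat_take_drop m (take n v)) take_takel // sumn_cat leq_addr.
Qed.

Lemma sumn_take n v : sumn (take n v) <= sumn v.
Proof. by rewrite -{2}(cat_take_drop n v) sumn_cat leq_addr. Qed.

Lemma LS_del m n F : m <= n -> LS F -> LS (fun x v => F x (take m v ++ drop n v)).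
Proof.
move=> le [e [K h]]; exists (EDel m n e), K => x v.
have [e1 b1] := h x (take m v ++ drop n v).
split=> //=; apply: bd_le b1; rewrite /pol.
case: K {h} => // K; rewrite leq_exp2r //.
by have := sumn_del v le; lia.
Qed.

Lemma LS_drop n F : LS F -> LS (fun x v => F x (drop n v)).
Proof. by move=> h; apply: LS_ext (LS_del (leq0n n) h) => x v; rewrite take0. Qed.

Lemma LS_take n F : LS F -> LS (fun x v => F x (take n v)).
Proof.
case=> e [K h]; exists (ETake n e), K => x v; have [e1 b1] := h x (take n v).
split=> //=; apply: bd_le b1; rewrite /pol.
case: K {h} => // K; rewrite leq_exp2r //.
by have := sumn_take n v; lia.
Qed.

Lemma LS_let F G : LS F -> LS G -> LS (fun x v => F x (G x v :: v)).
Proof.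
case=> e [K h] [e' [K' h']].
(* Only one value is pushed: [(K' + 0).+3] is the exponent of [pol_sum3] with the second value taken
   to be 0. *)
exists (ELet e' e), (K' + (K' + 0).+3 * K) => x v.
have [e1 b1] := h' x v; have [e2 b2] := h x (G x v :: v).
split; first by rewrite /= e1.
split; first by apply: bd_le b1; apply: pol_le; rewrite leq_addr.
rewrite e1; apply: bd_le b2.
apply: leq_trans (pol_le _ _ (leq_addl _ _)); apply: pol_comp.
have := bd_den b1; rewrite e1 => le.
apply: leq_trans (pol_sum3 le (leq0n (pol 0 x v))).
by rewrite /=; lia.
Qed.

Lemma LS_push n F G : LS F -> LS G -> LS (fun x v => F x (G x v :: drop n v)).
Proof.
move=> hF hG; apply: LS_ext (LS_let (LS_del (isT : 1 <= n.+1) hF) hG) => x v /=.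
by rewrite take0.
Qed.

Lemma LS_push2 n F G1 G2 : LS F -> LS G1 -> LS G2 ->
  LS (fun x v => F x [:: G1 x v, G2 x v & drop n v]).
Proof.
move=> hF h1 h2.
apply: LS_ext (LS_let (LS_let (LS_del (isT : 2 <= n.+2) hF) (LS_drop 1 h1)) h2) => x v /=.
by rewrite take0 drop0.
Qed.

Lemma eq_prec b f g n : (forall k a, k < n -> f k a = g k a) -> prec b f n = prec b g n.
Proof.
elim: n => //= n IH h; rewrite h // IH // => k a lt; apply: h; lia.
Qed.

(** Iterated doubling shows that recursion without a bound leads out of the class; bounding all
    intermediate values polynomially keeps the counters logarithmically short. *)
Lemma LS_prec_pol Kb N F0 (S : seq bool -> nat -> nat -> seq nat -> nat) :
  LS N -> LS F0 -> LS (fun x v => S x (nth 0 v 0) (nth 0 v 1) (drop 2 v)) ->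
  (forall x v k, k <= N x v -> prec (F0 x v) (fun k a => S x k a v) k <= pol Kb x v) ->
  LS (fun x v => prec (F0 x v) (fun k a => S x k a v) (N x v)).
Proof.
case=> [en [Kn hn]] [e0 [K0 h0]] [es [Ks hs]] hB.
have eS x k a v : den x es [:: k, a & v] = S x k a v.
  by have [-> _] := hs x [:: k, a & v]; rewrite /= drop0.
exists (ERec en e0 es), (Kn + K0 + (Kn + Kb).+3 * Ks) => x v.
have [e1 b1] := hn x v; have [e2 b2] := h0 x v; split=> /=.
  by rewrite e1 e2; apply: eq_prec => k a _; apply: eS.
split.
- by apply: bd_le b1; apply: pol_le; lia.
- by apply: bd_le b2; apply: pol_le; lia.
rewrite e1 e2 => k lt.
have -> : prec (F0 x v) (fun k a => den x es [:: k, a & v]) k =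
          prec (F0 x v) (fun k a => S x k a v) k.
  by apply: eq_prec => k' a _; apply: eS.
set a := prec _ _ k; have [_ b3] := hs x [:: k, a & v].
apply: bd_le b3; apply: leq_trans (pol_le _ _ (leq_addl _ _)); apply: pol_comp.
apply: pol_sum3.
  by apply: leq_trans (ltnW lt) _; rewrite -e1; apply: bd_den.
exact: hB (ltnW lt).
Qed.

Lemma LS_prec Bd N F0 (S : seq bool -> nat -> nat -> seq nat -> nat) :
  LS N -> LS F0 -> LS (fun x v => S x (nth 0 v 0) (nth 0 v 1) (drop 2 v)) -> LS Bd ->
  (forall x v k, k <= N x v -> prec (F0 x v) (fun k a => S x k a v) k <= Bd x v) ->
  LS (fun x v => prec (F0 x v) (fun k a => S x k a v) (N x v)).
Proof.
move=> hN h0 hS /LS_pol[K hK] hB; apply: (LS_prec_pol (Kb := K)) => // x v k le.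
exact: leq_trans (hB x v k le) (hK x v).
Qed.

Lemma LS_comp1 F G : LS F -> LS G -> LS (fun x v => F x [:: G x v]).
Proof.
move=> hF hG; apply: LS_ext (LS_let (LS_take 1 hF) hG) => x v /=.
by rewrite take0.
Qed.

Lemma LS_comp2 F G1 G2 : LS F -> LS G1 -> LS G2 ->
  LS (fun x v => F x [:: G1 x v; G2 x v]).
Proof.
move=> hF h1 h2.
apply: LS_ext (LS_push2 0 (LS_take 2 hF) h1 h2) => x v /=.
by rewrite take0.
Qed.

Definition LS1 (f : seq bool -> nat -> nat) := LS (fun x v => f x (nth 0 v 0)).
Definition LS2 (f : seq bool -> nat -> nat -> nat) :=
  LS (fun x v => f x (nth 0 v 0) (nth 0 v 1)).

Lemma LS_app1 f G : LS1 f -> LS G -> LS (fun x v => f x (G x v)).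
Proof. by move=> hf hG; have := LS_comp1 hf hG. Qed.

Lemma LS_app2 f G1 G2 : LS2 f -> LS G1 -> LS G2 -> LS (fun x v => f x (G1 x v) (G2 x v)).
Proof. by move=> hf h1 h2; have := LS_comp2 hf h1 h2. Qed.

Lemma LS_const c : LS (fun _ _ => c).
Proof. by elim: c => [|c]; [exact: LS_zero | apply: LS_succ]. Qed.

(** * Arithmetic, tests, tables and sums *)

Lemma LS_pred F : LS F -> LS (fun x v => (F x v).-1).
Proof.
apply: (@LS_app1 (fun _ n => n.-1)).
have e (x : seq bool) v : prec 0 (fun k _ => k) (nth 0 v 0) = (nth 0 v 0).-1.
  by case: (nth 0 v 0).
apply: (LS_ext e).
apply: (@LS_prec (fun _ v => nth 0 v 0) _ (fun _ _ => 0) (fun _ k _ _ => k));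
  [exact: LS_var | exact: LS_zero | exact: LS_var | exact: LS_var |].
by move=> x v [|k] //= /ltnW.
Qed.

Lemma LS_add F G : LS F -> LS G -> LS (fun x v => F x v + G x v).
Proof.
apply: (@LS_app2 (fun _ a b => a + b)).
have e (x : seq bool) v b : prec (nth 0 v 0) (fun _ c => c.+1) b = nth 0 v 0 + b.
  by elim: b => [|b IH] /=; rewrite ?addn0 // IH addnS.
apply: (LS_ext (fun x v => e x v _)).
apply: (@LS_prec_pol 1 _ _ (fun _ _ c _ => c.+1));
  [exact: LS_var | exact: LS_var | exact/LS_succ/LS_var |].
move=> x v k le; rewrite (e x) /pol expn1.
by case: v le => [|a [|b v]] /=; lia.
Qed.

Lemma LS_sub F G : LS F -> LS G -> LS (fun x v => F x v - G x v).
Proof.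
apply: (@LS_app2 (fun _ a b => a - b)).
have e (x : seq bool) v b : prec (nth 0 v 0) (fun _ c => c.-1) b = nth 0 v 0 - b.
  by elim: b => [|b IH] /=; rewrite ?subn0 // IH subnS.
apply: (LS_ext (fun x v => e x v _)).
apply: (@LS_prec (fun _ v => nth 0 v 0) _ _ (fun _ _ c _ => c.-1));
  [exact: LS_var | exact: LS_var | exact/LS_pred/LS_var | exact: LS_var |].
by move=> x v k le; rewrite (e x) leq_subr.
Qed.

Lemma LS_mul F G : LS F -> LS G -> LS (fun x v => F x v * G x v).
Proof.
apply: (@LS_app2 (fun _ a b => a * b)).
have e (x : seq bool) v b : prec 0 (fun _ c => nth 0 v 0 + c) b = nth 0 v 0 * b.
  by elim: b => [|b IH] /=; rewrite ?muln0 // IH mulnS.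
apply: (LS_ext (fun x v => e x v _)).
apply: (@LS_prec_pol 2 _ (fun _ _ => 0) (fun _ _ c v => nth 0 v 0 + c));
  [exact: LS_var | exact: LS_zero | |].
  by apply: LS_add; [apply: (LS_drop 2 (LS_var 0)) | exact: LS_var].
move=> x v k le; rewrite (e x) /pol.
have h0 := nth_sumn v 0; have h1 := nth_sumn v 1.
by rewrite expnS expn1; apply: leq_mul; lia.
Qed.

Definition LSb (P : seq bool -> seq nat -> bool) := LS (fun x v => nat_of_bool (P x v)).

Lemma LSb_leq F G : LS F -> LS G -> LSb (fun x v => F x v <= G x v).
Proof.
move=> hF hG; apply: LS_ext (LS_sub (LS_const 1) (LS_sub hF hG)) => x v.
by case: leqP; lia.
Qed.

Lemma LSb_ltn F G : LS F -> LS G -> LSb (fun x v => F x v < G x v).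
Proof. by move=> hF hG; apply: LSb_leq => //; apply: LS_succ. Qed.

Lemma LSb_and P Q : LSb P -> LSb Q -> LSb (fun x v => P x v && Q x v).
Proof.
move=> hP hQ; apply: LS_ext (LS_mul hP hQ) => x v; by case: (P x v); case: (Q x v).
Qed.

Lemma LSb_neg P : LSb P -> LSb (fun x v => ~~ P x v).
Proof. by move=> hP; apply: LS_ext (LS_sub (LS_const 1) hP) => x v; case: (P x v). Qed.

Lemma LSb_eq F G : LS F -> LS G -> LSb (fun x v => F x v == G x v).
Proof.
move=> hF hG; apply: LS_ext (LSb_and (LSb_leq hF hG) (LSb_leq hG hF)) => x v.
by rewrite eqn_leq.
Qed.

Lemma LS_if P F G : LSb P -> LS F -> LS G -> LS (fun x v => if P x v then F x v else G x v).
Proof.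
move=> hP hF hG.
apply: LS_ext (LS_add (LS_mul hP hF) (LS_mul (LSb_neg hP) hG)) => x v.
by case: (P x v) => /=; lia.
Qed.

Lemma LSb_if P Q1 Q2 : LSb P -> LSb Q1 -> LSb Q2 ->
  LSb (fun x v => if P x v then Q1 x v else Q2 x v).
Proof. by move=> hP h1 h2; apply: LS_ext (LS_if hP h1 h2) => x v; case: (P x v). Qed.

Lemma LSb_const b : LSb (fun _ _ => b).
Proof. exact: LS_const. Qed.

Lemma LS_minn F G : LS F -> LS G -> LS (fun x v => minn (F x v) (G x v)).
Proof. by move=> hF hG; apply: LS_if => //; apply: LSb_ltn. Qed.

Lemma LS_exp k F : LS F -> LS (fun x v => F x v ^ k).
Proof.
move=> hF; elim: k => [|k IH]; first exact: (LS_const 1).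
by apply: LS_ext (LS_mul hF IH) => x v; rewrite expnS.
Qed.

(** The quotient is counted up while its multiple of the divisor stays below the dividend; as many
    rounds as the dividend suffice, and division by 0 is treated apart. *)
Lemma LS_div F G : LS F -> LS G -> LS (fun x v => F x v %/ G x v).
Proof.
apply: (@LS_app2 (fun _ a b => a %/ b)).
pose S (k c a b : nat) := if c.+1 * b <= a then c.+1 else c.
have e (x : seq bool) (v : seq nat) a b k : 0 < b ->
  prec 0 (fun k c => S k c a b) k = minn k (a %/ b).
  move=> b0; elim: k => [|k IH] /=; first by rewrite min0n.
  by rewrite IH /S -leq_divRL //; case: leqP; lia.
have hS : LS (fun x v => prec 0 (fun k c => S k c (nth 0 v 0) (nth 0 v 1)) (nth 0 v 0)).
  apply: (@LS_prec (fun _ v => nth 0 v 0) _ (fun _ _ => 0)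
    (fun _ k c v => S k c (nth 0 v 0) (nth 0 v 1)));
    [exact: LS_var | exact: LS_zero | | exact: LS_var |].
    apply: LS_if; last exact: LS_var.
      apply: LSb_leq; last exact: (LS_drop 2 (LS_var 0)).
      by apply: LS_mul; [exact/LS_succ/LS_var | exact: (LS_drop 2 (LS_var 1))].
    exact/LS_succ/LS_var.
  move=> x v k le; apply: leq_trans le.
  by elim: k => //= k IH; rewrite {1}/S; case: ifP; lia.
apply: LS_ext (LS_if (LSb_eq (LS_var 1) LS_zero) LS_zero hS) => x v.
case: eqP => [-> | /eqP b0]; first by rewrite divn0.
by rewrite e ?lt0n //; have := leq_div (nth 0 v 0) (nth 0 v 1); lia.
Qed.

Lemma LS_mod F G : LS F -> LS G -> LS (fun x v => F x v %% G x v).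
Proof.
move=> hF hG; apply: LS_ext (LS_sub hF (LS_mul (LS_div hF hG) hG)) => x v.
by rewrite {1}(divn_eq (F x v) (G x v)) addKn.
Qed.

Lemma LSb_odd F : LS F -> LSb (fun x v => odd (F x v)).
Proof.
by move=> hF; apply: LS_ext (LS_mod hF (LS_const 2)) => x v; rewrite modn2.
Qed.

Lemma LS_iter_half F G : LS F -> LS G -> LS (fun x v => iter (G x v) half (F x v)).
Proof.
move=> hF hG; apply: (@LS_app2 (fun _ a b => iter b half a) F G) => //.
have e (x : seq bool) (v : seq nat) b :
    prec (nth 0 v 0) (fun _ c => c %/ 2) b = iter b half (nth 0 v 0).
  by elim: b => //= b ->; rewrite divn2.
apply: (LS_ext (fun x v => e x v _)).
apply: (@LS_prec (fun _ v => nth 0 v 0) _ _ (fun _ _ c _ => c %/ 2));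
  [exact: LS_var | exact: LS_var | | exact: LS_var |].
  by apply: LS_div; [exact: LS_var | exact: LS_const].
by move=> x v k _; rewrite (e x); elim: k => //= k IH; lia.
Qed.

Lemma LSb_bit F G : LS F -> LS G -> LSb (fun x v => bit (F x v) (G x v)).
Proof.
move=> hF hG; apply: LS_ext (LSb_odd (LS_iter_half hF hG)) => x v.
by rewrite bit_half_iter.
Qed.

(* capped, so that the values remain polynomially bounded for all arguments *)
Definition cpow (j w : nat) : nat := minn (2 ^ j) w.

Lemma LS_cpow F G : LS F -> LS G -> LS (fun x v => cpow (F x v) (G x v)).
Proof.
apply: (@LS_app2 (fun _ j w => cpow j w)).
have e (x : seq bool) (w j : nat) :
    prec (minn 1 w) (fun _ c => minn (2 * c) w) j = cpow j w.
  by elim: j => //= j ->; rewrite /cpow expnS; lia.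
apply: (LS_ext (fun x v => e x _ _)).
apply: (@LS_prec (fun _ v => nth 0 v 1) _ _ (fun _ _ c v => minn (2 * c) (nth 0 v 1))).
- exact: LS_var.
- by apply: LS_minn; [exact: LS_const | exact: LS_var].
- apply: LS_minn; last exact: (LS_drop 2 (LS_var 1)).
  by apply: LS_mul; [exact: LS_const | exact: LS_var].
- exact: LS_var.
by move=> x v k _; rewrite (e x) geq_minr.
Qed.

Lemma LS_nth (s : seq nat) F : LS F -> LS (fun x v => nth 0 s (F x v)).
Proof.
apply: (@LS_app1 (fun _ i => nth 0 s i)).
elim: s => [|a s IH]; first by apply: LS_ext LS_zero => x v; rewrite nth_nil.
have h := LS_app1 IH (LS_pred (LS_var 0)).
apply: LS_ext (LS_if (LSb_eq (LS_var 0) LS_zero) (LS_const a) h) => x v.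
by case: (nth 0 v 0).
Qed.

Lemma LS_sum N (S : seq bool -> nat -> seq nat -> nat) :
  LS N -> LS (fun x v => S x (nth 0 v 0) (drop 1 v)) ->
  LS (fun x v => \sum_(k < N x v) S x k v).
Proof.
move=> hN hS.
have e (x : seq bool) v n : prec 0 (fun k a => a + S x k v) n = \sum_(k < n) S x k v.
  by elim: n => [|n IH] /=; rewrite ?big_ord0 // big_ord_recr IH.
apply: (LS_ext (fun x v => e x v _)).
have [K hK] := LS_pol hS; have [K' hK'] := LS_pol hN.
(* There are at most [pol K'] summands, each at most [pol ((K' + 0).+3 * K)], hence the sum of the
   exponents. *)
apply: (@LS_prec_pol (K' + (K' + 0).+3 * K) _ (fun _ _ => 0)
  (fun x k a v => a + S x k v)) => //.
- exact: LS_zero.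
- apply: LS_add; first exact: LS_var.
  by apply: LS_ext (LS_push 2 hS (LS_var 0)) => x v /=; rewrite drop0.
move=> x v k le; rewrite e.
have hb i : i < N x v -> S x i v <= pol ((K' + 0).+3 * K) x v.
  move=> lt; have := hK x (i :: v); rewrite /= drop0 => h.
  apply: leq_trans h _; apply: pol_comp.
  apply: leq_trans (pol_sum3 (leq_trans (ltnW lt) (hK' x v)) (leq0n (pol 0 x v))).
  by rewrite /=; lia.
apply: (@leq_trans (\sum_(i < k) pol ((K' + 0).+3 * K) x v)).
  by apply: leq_sum => i _; apply: hb; apply: leq_trans le.
rewrite sum_nat_const card_ord /pol expnD -/(pol K' x v) leq_mul2r.
by rewrite (leq_trans le (hK' x v)) orbT.
Qed.

(** * Binary words computable in logarithmic space *)

(** A word is never stored: it is given by its length and by the letter at a position passed as an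
    additional first argument. Letters are recomputed whenever they are needed. *)
Definition LSl (G : seq bool -> seq nat -> seq bool) : Prop :=
  LS (fun x v => size (G x v)) /\
  LSb (fun x v => nth false (G x (drop 1 v)) (nth 0 v 0)).

Lemma LSl_ext F G : (forall x v, F x v = G x v) -> LSl F -> LSl G.
Proof.
move=> e [h1 h2]; split; first by apply: LS_ext h1 => x v; rewrite e.
by apply: LS_ext h2 => x v; rewrite e.
Qed.

Lemma LSl_nth G I : LSl G -> LS I -> LSb (fun x v => nth false (G x v) (I x v)).
Proof.
move=> [_ h] hI; apply: LS_ext (LS_let h hI) => x v /=.
by rewrite drop0.
Qed.

Lemma LSl_id : LSl (fun x _ => x).
Proof.
split; first exact: LS_size.
(* Input positions start at 1, and [icode] gives 2 for the letter [true]. *)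
apply: LS_ext (LSb_eq (LS_inp (LS_succ (LS_var 0))) (LS_const 2)) => x v.
rewrite /read_input /=; case: ltnP => h; first by case: nth.
by rewrite nth_default.
Qed.

Lemma LSl_const s : LSl (fun _ _ => s).
Proof.
split; first exact: LS_const.
apply: LS_ext (LS_nth (map nat_of_bool s) (LS_var 0)) => x v.
case: (ltnP (nth 0 v 0) (size s)) => h; first by rewrite (nth_map false).
by rewrite (nth_default false h) nth_default ?size_map.
Qed.

Lemma LSl_bit P : LSb P -> LSl (fun x v => [:: P x v]).
Proof.
move=> h; split; first exact: LS_const.
apply: LS_ext (LSb_and (LSb_eq (LS_var 0) LS_zero) (LS_drop 1 h)) => x v.
by case: (nth 0 v 0) => [|i] /=; rewrite ?nth_nil.
Qed.

Lemma LSl_cat F G : LSl F -> LSl G -> LSl (fun x v => F x v ++ G x v).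
Proof.
move=> [f1 f2] [g1 g2]; split.
  by apply: LS_ext (LS_add f1 g1) => x v; rewrite size_cat.
have s1 := LS_drop 1 f1.
have g := LS_push 1 g2 (LS_sub (LS_var 0) s1).
apply: LS_ext (LSb_if (LSb_ltn (LS_var 0) s1) f2 g) => x v.
by rewrite nth_cat /= drop0.
Qed.

Lemma LSl_if P F G : LSb P -> LSl F -> LSl G ->
  LSl (fun x v => if P x v then F x v else G x v).
Proof.
move=> hP [f1 f2] [g1 g2]; split.
  by apply: LS_ext (LS_if hP f1 g1) => x v; case: (P x v).
by apply: LS_ext (LSb_if (LS_drop 1 hP) f2 g2) => x v; case: (P _ _).
Qed.

Lemma LSl_drop n G : LSl G -> LSl (fun x v => G x (drop n v)).
Proof.
move=> [h1 h2]; split; first exact: (LS_drop n h1).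
apply: LS_ext (LS_push n.+1 h2 (LS_var 0)) => x v /=.
by rewrite drop0 drop_drop addn1.
Qed.

Lemma LSl_flatten N (G : seq bool -> nat -> seq nat -> seq bool) :
  LS N -> LSl (fun x v => G x (nth 0 v 0) (drop 1 v)) ->
  LSl (fun x v => flatten [seq G x k v | k <- iota 0 (N x v)]).
Proof.
move=> hN [h1 h2]; split.
  apply: LS_ext (LS_sum (S := fun x k v => size (G x k v)) hN h1) => x v.
  rewrite size_flatten /shape -map_comp sumnE big_map.
  by rewrite -[in RHS](subn0 (N x v)) -/(index_iota _ _) big_mkord.
(* The accumulator is either the letter already found, 0 or 1, or 2 plus the number of positions
   still to be skipped. A position past the end leaves a value of at least 2, which the final
   comparison with 1 reads as [false]. *)
pose st x k a v := if a < 2 then a else if a - 2 < size (G x k v)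
  then nat_of_bool (nth false (G x k v) (a - 2)) else a - size (G x k v).
have e x v i n : prec i.+2 (fun k a => st x k a v) n =
    let l := flatten [seq G x k v | k <- iota 0 n] in
    if i < size l then nat_of_bool (nth false l i) else (i - size l).+2.
  elim: n => [|n IH]; first by rewrite /= subn0.
  rewrite -[in iota 0 _]addn1 iotaD map_cat flatten_cat [prec _ _ _]/= IH /=.
  rewrite cats0 size_cat nth_cat.
  set l := flatten _; rewrite {1}/st; case: (ltnP i (size l)) => hi.
    by rewrite ltn_addr //; case: nth.
  rewrite /= !subSS subn0.
  have -> : (i < size l + size (G x n v)) = (i - size l < size (G x n v)).
    by lia.
  by rewrite add0n; case: ltnP => h //; lia.
have hp : LS (fun x v => prec (nth 0 v 0).+2 (fun k a => st x k a (drop 1 v))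
    (N x (drop 1 v))).
  have s1 : LS (fun x v => size (G x (nth 0 v 0) (drop 1 (drop 2 v)))).
    by apply: LS_ext (LS_push 3 h1 (LS_var 0)) => x v; rewrite /= drop0 drop_drop.
  apply: (@LS_prec (fun _ v => (nth 0 v 0).+2) _ _ (fun x k a v => st x k a (drop 1 v))).
  - exact: LS_drop.
  - exact/LS_succ/LS_succ/LS_var.
  - rewrite /st; apply: LS_if; [| exact: LS_var |].
      by apply: LSb_ltn; [exact: LS_var | exact: LS_const].
    apply: LS_if.
    + by apply: LSb_ltn => //; apply: LS_sub; [exact: LS_var | exact: LS_const].
    + apply: LS_ext (LS_push2 3 h2 (LS_sub (LS_var 1) (LS_const 2)) (LS_var 0)) => x v.
      by rewrite /= !drop0 drop_drop.
    by apply: LS_sub => //; exact: LS_var.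
  - exact/LS_succ/LS_succ/LS_var.
  move=> x v k _; rewrite e /=; case: ifP => _; last by lia.
  by case: nth.
apply: LS_ext (LSb_eq hp (LS_const 1)) => x v.
rewrite e /=; case: ltnP => h; first by case: nth.
by rewrite (nth_default false h).
Qed.

(** * Configurations of Turing machines as numbers *)

Lemma bit_ge n j : bit n j -> 2 ^ j <= n.
Proof. by move=> h; rewrite leqNgt; apply: contraL h => /bit_small ->. Qed.

Lemma lt_bits n K : (forall k, K <= k -> ~~ bit n k) -> n < 2 ^ K.
Proof.
elim: K n => [|K IH] n h.
  case: n h => // n h; have [p [_ _ b _]] := bit_pred (ltn0Sn n).
  by have := h p (leq0n p); rewrite b.
have : n./2 < 2 ^ K by apply: IH => k le; apply: (h k.+1).
by rewrite expnS; lia.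
Qed.

Definition set_bit (w j : nat) (b : bool) : nat :=
  (if bit w j then w - 2 ^ j else w) + (if b then 2 ^ j else 0).

Lemma bit_set w j b k : bit (set_bit w j b) k = if k == j then b else bit w k.
Proof.
elim: j w k => [|j IH] w k.
  rewrite /set_bit /= expn0; case: k => [|k] /=; first by case: b; case: ifP => ?; lia.
  by congr (bit _ k); case: (b); case: ifP => ?; lia.
have h2 : (set_bit w j.+1 b)./2 = set_bit w./2 j b.
  rewrite /set_bit /= expnS; case: ifP => [/bit_ge le | _]; case: (b); lia.
have ho : odd (set_bit w j.+1 b) = odd w.
  by rewrite /set_bit /= expnS; case: ifP => [/bit_ge le | _]; case: (b); lia.
by case: k => [|k] //=; rewrite h2 IH eqSS.
Qed.

Lemma mixed_lt a b A B : a < A -> b < B -> a * B + b < A * B.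
Proof. by move=> ha hb; have := leq_mul ha (leqnn B); rewrite mulSn; lia. Qed.

Section NumericMachine.
Variables (M : NTM) (y : seq bool) (W : nat).

(** A mixed-radix numeral. The work tape is the binary numeral [w], and [W] bounds both [w] and the
    head position [j]. *)
Definition encode (q i w j : nat) : nat :=
  ((j * W + w) * (size y).+2 + i) * tm_ns M + q.
Definition ncodes : nat := W * W * (size y).+2 * tm_ns M.
Definition dec_i (c : nat) := c %/ tm_ns M %% (size y).+2.
Definition dec_w (c : nat) := c %/ tm_ns M %/ (size y).+2 %% W.
Definition dec_j (c : nat) := c %/ tm_ns M %/ (size y).+2 %/ W.
Definition dec_q (c : nat) : 'I_(tm_ns M) := insubd (tm_start M) (c %% tm_ns M).

Lemma ns_gt0 : 0 < tm_ns M.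
Proof. exact: leq_ltn_trans (ltn_ord (tm_start M)). Qed.

Section Encode.
Variables (q : 'I_(tm_ns M)) (i w j : nat).
Hypotheses (hi : i < (size y).+2) (hw : w < W) (hj : j < W).

Lemma encode_div : encode q i w j %/ tm_ns M = (j * W + w) * (size y).+2 + i.
Proof. by rewrite /encode divnMDl ?ns_gt0 // divn_small ?addn0. Qed.

Lemma encode_q : dec_q (encode q i w j) = q.
Proof.
apply: val_inj; rewrite /dec_q /encode modnMDl modn_small //.
by rewrite val_insubd ltn_ord.
Qed.

Lemma encode_i : dec_i (encode q i w j) = i.
Proof. by rewrite /dec_i encode_div modnMDl modn_small. Qed.

Lemma encode_w : dec_w (encode q i w j) = w.
Proof.
by rewrite /dec_w encode_div divnMDl // (divn_small hi) addn0 modnMDl modn_small.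
Qed.

Lemma encode_j : dec_j (encode q i w j) = j.
Proof.
rewrite /dec_j encode_div divnMDl // (divn_small hi) addn0 divnMDl.
  by rewrite divn_small ?addn0.
exact: leq_ltn_trans hw.
Qed.

Lemma encode_lt : encode q i w j < ncodes.
Proof.
by rewrite /ncodes /encode; do 3 apply: mixed_lt => //.
Qed.
End Encode.

Definition trans (c : nat) :=
  @tm_delta M (dec_q c) (read_input y (dec_i c)) (bit (dec_w c) (dec_j c)).

(** Agrees with [set_bit] within the space bound, while the capped power remains polynomially
    bounded on arbitrary arguments. *)
Definition nset (w j : nat) (b : bool) : nat :=
  (if bit w j then w - cpow j W else w) + (if b then cpow j W else 0).

(** The reduction modulo [ncodes] leaves the simulated computations unchanged and keeps the
    successors of arbitrary numbers among the codes. *)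
Definition napply (c : nat) (t : 'I_(tm_ns M) * bool * Dir * Dir) : nat :=
  let: (q', b, di, dw) := t in
  encode q' (move_in y di (dec_i c)) (nset (dec_w c) (dec_j c) b)
    (move_work dw (dec_j c)) %% ncodes.

Definition nsucc (c : nat) : seq nat := map (napply c) (trans c).
Definition nhlt (c : nat) : bool := @tm_halt M (dec_q c).
Definition nacc (c : nat) : bool := @tm_acc M (dec_q c).

Fixpoint ngood (f c : nat) : bool :=
  nhlt c || (if f is f'.+1 then all (ngood f') (nsucc c) else false).

Fixpoint npaths (f c : nat) : nat :=
  if nhlt c then nat_of_bool (nacc c) else
  if f is f'.+1 then sumn (map (npaths f') (nsucc c)) else 0.

Lemma npaths_mono f f' c : ngood f c -> f <= f' -> npaths f' c = npaths f c.
Proof.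
elim: f f' c => [|f IH] [|f'] c //=; rewrite ?orbF; try by move=> ->.
case: ifP => //= _ /allP h le; congr sumn; apply/eq_in_map => c' /h g.
exact: IH.
Qed.

Lemma ncodes_gt0 : 0 < W -> 0 < ncodes.
Proof. by move=> h; rewrite !muln_gt0 h ns_gt0. Qed.

Lemma nsucc_lt c : 0 < W -> all (fun c' => c' < ncodes) (nsucc c).
Proof.
move=> W0; rewrite /nsucc; elim: (trans c) => //= -[[[q b] di] dw] l ->.
by rewrite ltn_pmod ?ncodes_gt0.
Qed.

(* The configurations all of whose computations halt form a least fixpoint,
   which is reached after as many iterations as there are configurations. *)
Definition halting_step (X : {set 'I_ncodes}) : {set 'I_ncodes} :=
  [set c : 'I_ncodes | nhlt c || all (fun c' => [exists d in X, val d == c']) (nsucc c)].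

Lemma ngood_ncodes f c : 0 < W -> c < ncodes -> ngood f c -> ngood ncodes c.
Proof.
move=> W0 ltc gd.
have mono : {homo halting_step : X Z / X \subset Z}.
  move=> X Z /subsetP XZ; apply/subsetP => d; rewrite !inE.
  case: (nhlt d) => //=; apply: sub_all => c' /existsP[e /andP[eX ec]].
  by apply/existsP; exists e; rewrite XZ.
have h1 g (d : 'I_ncodes) : ngood g d -> d \in iter g.+1 halting_step set0.
  elim: g d => [|g IH] d /=; rewrite inE; first by rewrite orbF => ->.
  case/orP => [-> // | /allP ha]; apply/orP; right; apply/allP => c' c'd.
  have lt' := allP (nsucc_lt d W0) _ c'd.
  apply/existsP; exists (Ordinal lt'); rewrite eqxx andbT.
  by apply: IH; apply: ha.
have h2 g (d : 'I_ncodes) : d \in iter g halting_step set0 -> ngood g d.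
  elim: g d => [|g IH] d /=; first by rewrite inE.
  rewrite inE; case/orP => [-> // | /allP ha]; apply/orP; right; apply/allP => c' c'd.
  by have /existsP[e /andP[eX /eqP <-]] := ha _ c'd; apply: IH.
have := h1 f (Ordinal ltc) gd => /(subsetP (iter_sub_fix mono _)).
by rewrite /fixset card_ord => /h2.
Qed.

Section Simulation.
Variable s : nat.
Hypothesis sW : 2 ^ s.+1 <= W.

Lemma lt_W j : j <= s.+1 -> j < W.
Proof.
move=> h; apply: leq_trans sW; apply: leq_ltn_trans (ltn_expl s.+1 (isT : 1 < 2)).
exact: leq_trans h _.
Qed.

Lemma nset_bit w j b : w < 2 ^ s.+1 -> j <= s -> nset w j b = set_bit w j b.
Proof.
move=> hw js; rewrite /nset /set_bit /cpow.
have -> // : minn (2 ^ j) W = 2 ^ j.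
by apply/minn_idPl; apply: leq_trans sW; rewrite leq_exp2l // ltnW.
Qed.

Lemma set_bit_lt w j b : w < 2 ^ s.+1 -> j <= s -> set_bit w j b < 2 ^ s.+1.
Proof.
move=> hw js; apply: lt_bits => k le; rewrite bit_set ifN; last by lia.
by rewrite bit_small //; apply: leq_trans hw _; rewrite leq_exp2l.
Qed.

Lemma move_in_lt d i : i < (size y).+2 -> move_in y d i < (size y).+2.
Proof. by case: d => /=; lia. Qed.

(** The tape starts blank and only cells up to [s] are written, so its contents always have the form
    [bit w] with [w < 2 ^ s.+1]. *)
Lemma npaths_sim f (q : 'I_(tm_ns M)) i w j : i < (size y).+2 -> w < 2 ^ s.+1 ->
  j <= s.+1 -> good y s f ((q, i, bit w, j) : config M) ->
  ngood f (encode q i w j) /\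
  acc_paths y f ((q, i, bit w, j) : config M) = npaths f (encode q i w j).
Proof.
elim: f q i w j => [|f IH] q i w j hi hw /lt_W jW /= [js hg];
  have wW : w < W by [exact: leq_trans sW];
  rewrite /nhlt /nacc !encode_q //; first by case: hg => // ->.
case: (boolP (tm_halt q)) hg => hq hg; first by [].
case: hg => //= hg.
rewrite /nsucc /trans encode_q ?encode_i ?encode_w ?encode_j // all_map -map_comp.
rewrite -map_comp; move: hg.
elim: (tm_delta _ _ _) => //= -[[[q' b] di] dw] l IHl hg.
have [| -> ->] := IHl; first by move=> c' c'l; apply: hg; right.
have {hg} := hg _ (or_introl erefl).
have -> : (fun k => if k == j then b else bit w k) = bit (set_bit w j b).
  by apply: functional_extensionality => k; rewrite bit_set.
have w' := set_bit_lt b hw js.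
have i' := move_in_lt di hi.
have j' : move_work dw j <= s.+1 by case: (dw) => /=; lia.
case/IH => // g e; rewrite /napply encode_i ?encode_w ?encode_j // nset_bit //.
have lt := encode_lt q' i' (leq_trans w' sW) (lt_W j').
by rewrite (modn_small lt) g e.
Qed.

(** The fuel [f] comes without a bound. Both [f] and [ncodes] suffice for the initial configuration,
    so the two counts agree with the count for their maximum. *)
Lemma acc_paths_ncodes f : good y s f (init_config M) ->
  acc_paths y f (init_config M) = npaths ncodes (encode (tm_start M) 0 0 0).
Proof.
have W0 : 0 < W by apply: lt_W.
have -> : init_config M = (tm_start M, 0, bit 0, 0).
  congr (_, _, _, _); apply: functional_extensionality => k; by rewrite bit0.
move=> g; have [|||h ->] := npaths_sim _ _ _ g; rewrite ?expn_gt0 //.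
have lt := @encode_lt (tm_start M) 0 0 0 (ltn0Sn _) W0 W0.
have hN := ngood_ncodes W0 lt h.
rewrite -(npaths_mono h (leq_maxl f ncodes)).
exact: npaths_mono hN (leq_maxr f ncodes).
Qed.

End Simulation.

Lemma deterministic_npaths f c : deterministic M ->
  npaths f c = (let c' := iter f (fun c => if nhlt c then c else head c (nsucc c)) c in
                nhlt c' && nacc c').
Proof.
move=> det; elim: f c => [|f IH] c; first by rewrite /=; case: ifP.
rewrite iterSr /=; case: ifP => hc.
  by rewrite iter_fix ?hc.
have : size (nsucc c) <= 1 by rewrite size_map; apply: det.
case e: (nsucc c) => [|c' [|]] //= _; last by rewrite addn0 IH.
(* A configuration without successors is fixed by the iteration through the default of [head]; as it
   does not halt, it is not accepting. *)
by rewrite iter_fix ?hc ?e.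
Qed.

End NumericMachine.

(** * Simulation of machines within the class *)

Lemma LS_encode M (G : seq bool -> seq nat -> seq bool) (W Q I V J : fn) : LSl G -> LS W ->
  LS Q -> LS I -> LS V -> LS J ->
  LS (fun x v => encode M (G x v) (W x v) (Q x v) (I x v) (V x v) (J x v)).
Proof.
move=> [hG _] hW hQ hI hV hJ; apply: LS_add => //; apply: LS_mul; last exact: LS_const.
apply: LS_add => //; apply: LS_mul; last exact/LS_succ/LS_succ.
by apply: LS_add => //; apply: LS_mul.
Qed.

Lemma LS_ncodes M (G : seq bool -> seq nat -> seq bool) (W : fn) : LSl G -> LS W ->
  LS (fun x v => ncodes M (G x v) (W x v)).
Proof.
move=> [hG _] hW; apply: LS_mul; last exact: LS_const.
by apply: LS_mul; [apply: LS_mul | apply/LS_succ/LS_succ].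
Qed.

Section Numeric.
Variables (M : NTM) (G : seq bool -> seq nat -> seq bool) (W C : fn).
Hypotheses (hG : LSl G) (hW : LS W) (hC : LS C).

Lemma LS_icode I : LS I -> LS (fun x v => icode (read_input (G x v) (I x v))).
Proof.
move=> hI; have hn := LSl_nth hG (LS_pred hI); have [hs _] := hG.
have hc := LSb_and (LSb_ltn LS_zero hI) (LSb_leq hI hs).
apply: LS_ext (LS_if hc (LS_succ hn) LS_zero) => x v.
by rewrite /read_input; case: ifP.
Qed.

Lemma LS_dec_i : LS (fun x v => dec_i M (G x v) (C x v)).
Proof.
apply: LS_mod; last by apply/LS_succ/LS_succ; case: hG.
by apply: LS_div => //; apply: LS_const.
Qed.

Lemma LS_dec_wj : LS (fun x v => C x v %/ tm_ns M %/ (size (G x v)).+2).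
Proof.
apply: LS_div; last by apply/LS_succ/LS_succ; case: hG.
by apply: LS_div => //; apply: LS_const.
Qed.

Lemma LS_dec_w : LS (fun x v => dec_w M (G x v) (W x v) (C x v)).
Proof. by apply: LS_mod => //; apply: LS_dec_wj. Qed.

Lemma LS_dec_j : LS (fun x v => dec_j M (G x v) (W x v) (C x v)).
Proof. by apply: LS_div => //; apply: LS_dec_wj. Qed.

(** State, symbol and bit take finitely many values, six per state, so [g] is a constant table
    indexed by their mixed-radix number. *)
Lemma LS_table (g : 'I_(tm_ns M) -> option bool -> bool -> nat) A P :
  LS (fun x v => icode (A x v)) -> LSb P ->
  LS (fun x v => g (dec_q M (C x v)) (A x v) (P x v)).
Proof.
move=> hA hP.
pose tab := mkseq (fun t => g (insubd (tm_start M) (t %/ 6))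
  (if t %/ 2 %% 3 is a.+1 then Some (a == 1) else None) (odd t)) (6 * tm_ns M).
have hI : LS (fun x v => (C x v %% tm_ns M * 3 + icode (A x v)) * 2 + P x v).
  apply: LS_add => //; apply: LS_mul; last exact: LS_const.
  apply: LS_add => //; apply: LS_mul; last exact: LS_const.
  by apply: LS_mod => //; apply: LS_const.
apply: LS_ext (LS_nth tab hI) => x v.
have := ltn_pmod (C x v) (ns_gt0 M); rewrite /dec_q.
move: (C x v %% _) (A x v) (P x v) => q a b lt.
have ha : icode a < 3 by case: a => // -[].
rewrite /tab nth_mkseq; last by case: b; lia.
have -> : ((q * 3 + icode a) * 2 + b) %/ 6 = q by case: b; lia.
have -> : ((q * 3 + icode a) * 2 + b) %/ 2 %% 3 = icode a by case: b; lia.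
have -> : odd ((q * 3 + icode a) * 2 + b) = b by case: b; lia.
by case: a {ha} => // -[].
Qed.

Lemma LSb_nhlt : LSb (fun x v => nhlt M (C x v)).
Proof.
exact: (LS_table (fun q _ _ => @tm_halt M q) (A := fun _ _ => None)
  (LS_const 0) (LSb_const true)).
Qed.

Lemma LSb_nacc : LSb (fun x v => nacc M (C x v)).
Proof.
exact: (LS_table (fun q _ _ => @tm_acc M q) (A := fun _ _ => None)
  (LS_const 0) (LSb_const true)).
Qed.

Lemma LS_trans (g : seq ('I_(tm_ns M) * bool * Dir * Dir) -> nat) :
  LS (fun x v => g (trans M (G x v) (W x v) (C x v))).
Proof.
apply: (LS_table (fun q a b => g (@tm_delta M q a b))).
  exact/LS_icode/LS_dec_i.
by apply: LSb_bit; [exact: LS_dec_w | exact: LS_dec_j].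
Qed.

Lemma LS_size_nsucc : LS (fun x v => size (nsucc M (G x v) (W x v) (C x v))).
Proof. by apply: LS_ext (LS_trans size) => x v; rewrite size_map. Qed.

Definition dcode (d : Dir) : nat := match d with Lft => 0 | Stay => 1 | Rgt => 2 end.

Lemma LS_move_in D I : LS (fun x v => dcode (D x v)) -> LS I ->
  LS (fun x v => move_in (G x v) (D x v) (I x v)).
Proof.
move=> hD hI; have [hs _] := hG.
have h1 := LS_if (LSb_eq hD (LS_const 1)) hI (LS_minn (LS_succ hI) (LS_succ hs)).
apply: LS_ext (LS_if (LSb_eq hD LS_zero) (LS_pred hI) h1) => x v.
by case: (D x v).
Qed.

Lemma LS_move_work D I : LS (fun x v => dcode (D x v)) -> LS I ->
  LS (fun x v => move_work (D x v) (I x v)).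
Proof.
move=> hD hI.
have h1 := LS_if (LSb_eq hD (LS_const 1)) hI (LS_succ hI).
apply: LS_ext (LS_if (LSb_eq hD LS_zero) (LS_pred hI) h1) => x v.
by case: (D x v).
Qed.

Lemma LS_nset (V J : fn) P : LS V -> LS J -> LSb P ->
  LS (fun x v => nset (W x v) (V x v) (J x v) (P x v)).
Proof.
move=> hV hJ hP; apply: LS_add; apply: LS_if => //.
- exact: LSb_bit.
- by apply: LS_sub => //; apply: LS_cpow.
- exact: LS_cpow.
exact: LS_zero.
Qed.

Lemma LS_nth_nsucc r : LS (fun x v => nth 0 (nsucc M (G x v) (W x v) (C x v)) r).
Proof.
pose t0 := (tm_start M, false, Stay, Stay).
pose T x v := nth t0 (trans M (G x v) (W x v) (C x v)) r.
have hq : LS (fun x v => val (T x v).1.1.1).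
  by exact: (LS_trans (fun l => val (nth t0 l r).1.1.1)).
have hb : LSb (fun x v => (T x v).1.1.2).
  by exact: (LS_trans (fun l => (nth t0 l r).1.1.2)).
have hi : LS (fun x v => dcode (T x v).1.2).
  by exact: (LS_trans (fun l => dcode (nth t0 l r).1.2)).
have hj : LS (fun x v => dcode (T x v).2).
  by exact: (LS_trans (fun l => dcode (nth t0 l r).2)).
have happ := LS_mod (LS_encode M hG hW hq (LS_move_in hi LS_dec_i)
  (LS_nset LS_dec_w LS_dec_j hb) (LS_move_work hj LS_dec_j)) (LS_ncodes M hG hW).
apply: LS_ext (LS_if (LSb_ltn (LS_const r) (LS_trans size)) happ LS_zero) => x v.
case: ltnP => h; last by rewrite nth_default // size_map.
by rewrite (nth_map t0) // /napply -/(T x v); case: (T x v) => [[[]]].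
Qed.

End Numeric.

(* an upper bound on 2 ^ (log_space k y).+1, in which no logarithm has to be computed *)
Definition tape_bound (k : nat) (y : seq bool) : nat := 2 * (2 * size y + 2) ^ k.

(** For positive [n], [2 ^ (trunc_log 2 n).+1 <= 2 * n]; the summand 2 takes care of the empty
    word. *)
Lemma tape_boundP k y : 2 ^ (log_space k y).+1 <= tape_bound k y.
Proof.
rewrite expnS leq_pmul2l // /log_space mulnC expnM.
case: k => // k; rewrite leq_exp2r //.
case: (posnP (size y)) => [-> // | y0].
by have := trunc_logP (isT : 1 < 2) y0; rewrite expnS; lia.
Qed.

Lemma LS_tape_bound k G : LSl G -> LS (fun x v => tape_bound k (G x v)).
Proof.
move=> [hs _]; apply: LS_mul; first exact: LS_const.
apply: LS_exp; apply: LS_add; last exact: LS_const.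
by apply: LS_mul => //; apply: LS_const.
Qed.

Lemma LS_in_L (A : language) (F : fn) : LS F -> (forall x, A x <-> F x [::] != 0) -> in_L A.
Proof.
case=> e [K h] hA; apply: (@in_L_decider A e K) => x.
have [eF b] := h x [::]; rewrite hA eF; split=> //.
by move: b; rewrite /pol addn0.
Qed.

Definition nstep M (y : seq bool) (w c : nat) : nat :=
  if nhlt M c then c else head c (nsucc M y w c).

Lemma LS_nstep M G (W C : fn) : LSl G -> LS W -> LS C ->
  LS (fun x v => nstep M (G x v) (W x v) (C x v)).
Proof.
move=> hG hW hC.
have h := LS_if (LSb_eq (LS_size_nsucc M hG hW hC) LS_zero) hC (LS_nth_nsucc M hG hW hC 0).
apply: LS_ext (LS_if (LSb_nhlt M hC) hC h) => x v.
by rewrite /nstep; case: (nsucc _ _ _ _).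
Qed.

Lemma nstep_le M y w c : 0 < w -> c <= ncodes M y w -> nstep M y w c <= ncodes M y w.
Proof.
move=> w0 h; rewrite /nstep; case: (nhlt M c) => //.
by have := nsucc_lt M y c w0; case: (nsucc _ _ _ _) => //= c' l /andP[/ltnW].
Qed.

(** The machine is run on the virtual word [G x v], each symbol being computed when the input head
    looks at it; [ncodes] steps suffice. This is the composition of a decider with a reduction. *)
Lemma in_L_LSb (A : language) G : in_L A -> LSl G ->
  exists P, LSb P /\ forall x v, A (G x v) <-> P x v.
Proof.
case=> M [k [det h]] hG.
pose W x v := tape_bound k (G x v).
have W0 x v : 0 < W x v by apply: leq_trans (tape_boundP _ _); rewrite expn_gt0.
have hW : LS W by exact: LS_tape_bound.
pose N x v := ncodes M (G x v) (W x v).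
have hN : LS N by exact: LS_ncodes.
pose c0 x v := encode M (G x v) (W x v) (tm_start M) 0 0 0.
have hc0 : LS c0 by apply: LS_encode => //; exact: LS_const.
pose F x v := prec (c0 x v) (fun _ c => nstep M (G x v) (W x v) c) (N x v).
have hF : LS F.
  apply: (@LS_prec N _ _ (fun x _ c v => nstep M (G x v) (W x v) c)) => //.
    apply: LS_nstep; [exact: (LSl_drop 2) | exact: (LS_drop 2) | exact: LS_var].
  move=> x v f _; elim: f => [|f IH] /=; last exact: nstep_le.
  by apply: ltnW; apply: encode_lt.
exists (fun x v => nhlt M (F x v) && nacc M (F x v)); split.
  by apply: LSb_and; [exact: LSb_nhlt | exact: LSb_nacc].
move=> x v; have [fuel [g ->]] := h (G x v).
rewrite (acc_paths_ncodes (tape_boundP k _) g) deterministic_npaths //.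
have -> : F x v = iter (N x v) (fun c => if nhlt M c then c
   else head c (nsucc M (G x v) (W x v) c)) (c0 x v).
  by rewrite /F; elim: (N x v) => //= n ->.
by rewrite lt0b.
Qed.

(** A deterministic machine has at most one accepting path, so a positive number of paths is an odd
    one. *)
Lemma in_L_ParityL A : in_L A -> in_ParityL A.
Proof.
case=> M [k [det h]]; exists M, k => x; have [fuel [g e]] := h x.
exists fuel; split=> //; rewrite e.
suff : acc_paths x fuel (init_config M) <= 1 by case: (acc_paths _ _ _) => [|[]].
elim: fuel (init_config M) {g e} => [|f IH] c /=; case: ifP => // _; try by case: tm_acc.
have : size (step x c) <= 1.
  by case: c => [[[q i] w] j] /=; rewrite size_map; apply: det.
by case: (step x c) => [|c' []] //= _; rewrite addn0.
Qed.

(** * Autoepistemic formulae *)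

Lemma aeform_ind_nested (P : aeform -> Prop) :
  (forall p, P (AVar p)) ->
  (forall i args, List.Forall P args -> P (AApp i args)) ->
  (forall phi, P phi -> P (AL phi)) -> forall phi, P phi.
Proof.
move=> hV hA hL; fix IH 1 => -[p | i args | phi]; [exact: hV | apply: hA | exact/hL/IH].
by elim: args => [|a l IHl]; constructor.
Qed.

(** The terminator is essential: the code of [xH] alone is a prefix of the code of every [xI q]. *)
Lemma enc_pos_inj p q s t :
  enc_pos p ++ false :: s = enc_pos q ++ false :: t -> p = q /\ s = t.
Proof.
elim: p q => [p IH | p IH | ] [q | q | ] //= [] =>
  [/IH[-> ->] | h | /IH[-> ->] | h | ->] //.
- by case: p {IH} h.
by case: q h.
Qed.

Lemma enc_nat_inj m n s t : enc_nat m ++ s = enc_nat n ++ t -> m = n /\ s = t.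
Proof.
rewrite /enc_nat => h.
suff : N.of_nat m = N.of_nat n /\ s = t by case=> /Nnat.Nat2N.inj -> ->.
move: h; case: (N.of_nat m) (N.of_nat n) => [|p] [|q] /=.
- by case.
- by case: q.
- by case: p.
by rewrite -!catA => /enc_pos_inj[-> ->].
Qed.

Lemma enc_form_inj phi psi s t :
  enc_form phi ++ s = enc_form psi ++ t -> phi = psi /\ s = t.
Proof.
elim/aeform_ind_nested: phi psi s t => [p | i args IH | phi IH]
  [q | j args' | psi] s t //= [].
- by move/enc_nat_inj => [-> ->].
- rewrite -!catA => /enc_nat_inj[<-] /enc_nat_inj[es] h.
  suff : args = args' /\ s = t by case=> -> ->.
  elim: IH args' es h => [|a l ha _ IHl] [|a' l'] //= [es].
  by rewrite -!catA => /ha[<-] /(IHl _ es)[-> ->].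
by move/IH => [-> ->].
Qed.

Lemma enc_inst_inj S T : enc_inst S = enc_inst T -> S = T.
Proof.
rewrite /enc_inst; elim: S T => [|phi S IH] [|psi T] //= [].
by rewrite -!catA => /enc_form_inj[-> /IH ->].
Qed.

(** * Computable codes of numbers and formulae *)

(** Rewrites the recursive code as a flattened family of words, to which [LSl_flatten] applies.
    Indices past the leading digit contribute the empty word, so any bound [K] on the number of
    digits will do. *)
Definition digits (n K : nat) : seq bool :=
  flatten [seq if iter k half n == 0 then [::] else [:: true; bit n k] | k <- iota 0 K].

Lemma digitsS n K :
  digits n K.+1 = (if n == 0 then [::] else [:: true; odd n]) ++ digits n./2 K.
Proof.
rewrite /digits /= -[1]addn0 iotaDl -map_comp; congr (_ ++ flatten _).
by apply: eq_map => k /=; rewrite -iterSr.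
Qed.

Lemma digits0 K : digits 0 K = [::].
Proof. by elim: K => // K IH; rewrite digitsS IH. Qed.

Lemma digits_pos p K : Pos.to_nat p < 2 ^ K -> digits (Pos.to_nat p) K = enc_pos p.
Proof.
elim: p K => [p IH | p IH | ] [|K]; rewrite ?expn0 ?expnS => h; try lia; rewrite digitsS.
- case: eqP => [|_]; first by lia.
  have -> : odd (Pos.to_nat p~1) = true by lia.
  by have -> : (Pos.to_nat p~1)./2 = Pos.to_nat p; [lia | rewrite IH //; lia].
- case: eqP => [|_]; first by lia.
  have -> : odd (Pos.to_nat p~0) = false by lia.
  by have -> : (Pos.to_nat p~0)./2 = Pos.to_nat p; [lia | rewrite IH //; lia].
by rewrite digits0.
Qed.

Lemma enc_natE n : enc_nat n = digits n n ++ [:: false].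
Proof.
rewrite /enc_nat; case e: (N.of_nat n) => [|p]; first by have -> : n = 0 by lia.
have -> : n = Pos.to_nat p by lia.
by rewrite digits_pos // ltn_expl.
Qed.

Lemma LSl_enc_nat F : LS F -> LSl (fun x v => enc_nat (F x v)).
Proof.
move=> hF.
have h : LSl (fun x v => digits (F x v) (F x v) ++ [:: false]).
  apply: LSl_cat; last exact: LSl_const.
  apply: (LSl_flatten (G := fun x k v => if iter k half (F x v) == 0 then [::]
     else [:: true; bit (F x v) k]) hF).
  apply: LSl_if.
  - apply: LSb_eq; last exact: LS_zero.
    by apply: LS_iter_half; [exact: (LS_drop 1) | exact: LS_var].
  - exact: LSl_const.
  apply: (LSl_cat (LSl_const [:: true])); apply: LSl_bit.
  by apply: LSb_bit; [exact: (LS_drop 1) | exact: LS_var].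
by apply: LSl_ext h => x v; rewrite enc_natE.
Qed.

Fixpoint subst (tau : nat -> aeform) (phi : aeform) : aeform :=
  match phi with
  | AVar p => tau p
  | AApp i args => AApp i (map (subst tau) args)
  | AL psi => AL (subst tau psi)
  end.

Lemma eq_map_Forall T S (f g : T -> S) (l : seq T) :
  List.Forall (fun a => f a = g a) l -> map f l = map g l.
Proof. by elim=> //= a s -> _ ->. Qed.

Lemma Forall_all T (P : T -> Prop) (q : T -> bool) l :
  List.Forall (fun a => q a -> P a) l -> all q l -> List.Forall P l.
Proof.
by elim=> [_ | a s ha _ IH /= /andP[/ha pa /IH]]; constructor.
Qed.

Lemma eval_pure B vp vL vL' phi : pure phi -> eval B vp vL phi = eval B vp vL' phi.
Proof.
elim/aeform_ind_nested: phi => //= i args IH h; congr bf_fun; apply: eq_map_Forall.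
exact: Forall_all IH h.
Qed.

Lemma eval_subst B vp vL tau phi : pure phi ->
  eval B vp vL (subst tau phi) = eval B (fun p => eval B vp vL (tau p)) vL phi.
Proof.
elim/aeform_ind_nested: phi => //= i args IH h; congr bf_fun; rewrite -map_comp.
apply: eq_map_Forall.
exact: Forall_all IH h.
Qed.

Lemma wf_subst B tau phi : (forall p, wf B (tau p)) -> wf B phi -> wf B (subst tau phi).
Proof.
move=> ht; elim/aeform_ind_nested: phi => //= i args IH /andP[/andP[-> h]].
rewrite size_map h /= all_map.
by elim: IH {h} => //= a l ha _ IHl /andP[/ha-> /IHl].
Qed.

Lemma pure_subst tau phi : (forall p, pure (tau p)) -> pure phi -> pure (subst tau phi).
Proof.
move=> ht; elim/aeform_ind_nested: phi => //= i args IH; rewrite all_map.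
by elim: IH => //= a l ha _ IHl /andP[/ha-> /IHl].
Qed.

(** The formula [phi] is fixed, so the recursion on its structure takes place outside the class;
    only the variable names depend on the input. *)
Lemma LSl_enc_subst (sigma : seq bool -> seq nat -> nat -> nat) phi :
  (forall p, LS (fun x v => sigma x v p)) ->
  LSl (fun x v => enc_form (subst (fun p => AVar (sigma x v p)) phi)).
Proof.
move=> h; elim/aeform_ind_nested: phi => [p | i args IH | phi IH] /=.
- exact: (LSl_cat (LSl_const [:: false; false]) (LSl_enc_nat (h p))).
- apply: (LSl_cat (LSl_const [:: false; true])).
  apply: (LSl_cat (LSl_const (enc_nat i))).
  apply: LSl_cat.
    by apply: LSl_ext (LSl_const (enc_nat (size args))) => x v; rewrite size_map.
  by elim: IH => [|a l ha _ IHl] /=; [exact: LSl_const | exact: LSl_cat].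
exact: (LSl_cat (LSl_const [:: true; false])).
Qed.

(** * Stable expansions of objective formulae with one premise L p *)

Section Expansions.
Variables (B : seq BoolFun) (S : seq aeform) (p : nat).
Hypothesis pureS : all pure S.

Definition models (vp : nat -> bool) : Prop :=
  forall sigma, List.In sigma S -> eval B vp (fun=> false) sigma.

Definition asbool (P : Prop) : bool :=
  if excluded_middle_informative P then true else false.

Lemma asboolP P : reflect P (asbool P).
Proof. by rewrite /asbool; case: excluded_middle_informative => h; constructor. Qed.

(* The only stable expansion of a set of objective formulae, by recursion on
   the nesting depth of L. *)
Fixpoint kernel_eval (phi : aeform) (vp : nat -> bool) : bool :=
  match phi with
  | AVar q => vp q
  | AApp i args => bf_fun (nth dflt_bf B i) (map (fun a => kernel_eval a vp) args)
  | AL psi => asbool (forall vp', models vp' -> kernel_eval psi vp')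
  end.

Definition kernel (phi : aeform) : bool :=
  asbool (forall vp, models vp -> kernel_eval phi vp).

Lemma kernel_evalE vp vL phi : (forall psi, wf B psi -> vL psi = kernel psi) ->
  wf B phi -> eval B vp vL phi = kernel_eval phi vp.
Proof.
move=> hL; elim/aeform_ind_nested: phi => //= [i args IH | psi _ /hL //].
move=> /andP[_ h]; congr bf_fun; apply: eq_map_Forall.
exact: Forall_all IH h.
Qed.

Lemma models_eval vp vL : models vp <->
  (forall sigma, List.In sigma S -> eval B vp vL sigma = true).
Proof.
have h sigma : List.In sigma S -> pure sigma.
  by elim: (S) pureS => //= a l IH /andP[ha hl] [<- // | /(IH hl)].
by split=> m sigma hs; have := m sigma hs;
  rewrite (eval_pure B vp vL (fun=> false) (h _ hs)).
Qed.

(** An expansion without p would contain both L p and its negation, hence every formula, p included.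
    So p belongs to the expansion, and since [S] contains no L-atoms, fixing their values does not
    help in deriving p. *)
Lemma stable_expansion_entails :
  (exists Delta, stable_expansion B (AL (AVar p) :: S) Delta) <->
  (forall vp, models vp -> vp p).
Proof.
split=> [[Delta [wfD hD]] vp mvp | hp].
  have Dp : Delta (AVar p).
    apply/(hD (AVar p) isT) => vp' vL hL hS.
    have Dp := proj1 (hL (AVar p) isT) (hS _ (or_introl erefl)).
    exact (proj1 (hD (AVar p) isT) Dp vp' vL hL hS).
  have := proj1 (hD (AVar p) isT) Dp vp (fun psi => asbool (Delta psi)); apply.
    by move=> psi _; split=> [/asboolP | /asboolP].
  by move=> sigma [<- /= | hs]; [exact/asboolP | exact: (proj1 (models_eval _ _) mvp)].
(* The expansion of [S] alone contains p, hence already satisfies the added premise. *)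
pose Delta phi := wf B phi /\ kernel phi.
exists Delta; split; first by move=> phi [].
move=> phi wphi; split=> [[_ /asboolP hk] vp vL hL hS | h].
  rewrite (@kernel_evalE vp vL) //; last first.
    by move=> psi wpsi; apply/idP/idP => [/hL[] // | kp]; apply/hL.
  apply: hk; apply/(models_eval _ vL) => sigma hs; apply: hS; by right.
split=> //; apply/asboolP => vp mvp.
rewrite -(@kernel_evalE vp kernel) //; apply: h.
  by move=> psi wpsi; split=> [| []].
move=> sigma [<- /= | hs]; last exact: (proj1 (models_eval _ _) mvp).
exact/asboolP.
Qed.
End Expansions.

(** * The reduction from parity logspace *)

Section Template.
Variables (B : seq BoolFun).
Hypotheses (cloneX : in_clone B 2 xor_fun) (cloneT : in_clone B 1 (fun _ => true)).

(** The formula states a homogeneous linear equation in [d] variables. Nested substitution may make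
    it large, as a variable can occur repeatedly in [X], but [d] will depend on the machine only. *)
Lemma parity_template d : exists phi, [/\ wf B phi, pure phi &
  forall vp vL, eval B vp vL phi = ~~ \big[addb/false]_(r < d) vp r].
Proof.
have [X [wX [pX eX]]] := cloneX; have [T [wT [pT eT]]] := cloneT.
elim: d => [|d [phi [w p e]]].
  by exists T; split=> // vp vL; rewrite eT big_ord0.
exists (subst (fun q => if q == 0 then phi else AVar d) X); split.
- by apply: wf_subst => // q; case: ifP.
- by apply: pure_subst => // q; case: ifP.
move=> vp vL; rewrite eval_subst // eX /xor_fun /= e big_ord_recr /=.
by case: (vp d); case: (bigop _ _ _).
Qed.
End Template.

Lemma odd_sumn (T : Type) (f : T -> nat) l :
  odd (sumn (map f l)) = \big[addb/false]_(c <- l) odd (f c).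
Proof. by elim: l => [|c l IH]; rewrite ?big_nil // big_cons /= oddD IH. Qed.

Lemma In_map_iota (T : Type) (f : nat -> T) n y :
  List.In y (map f (iota 0 n)) <-> exists2 u, u < n & y = f u.
Proof.
have -> : (exists2 u, u < n & y = f u) <-> exists2 u, u \in iota 0 n & y = f u.
  by split=> -[u hu ->]; exists u; rewrite // mem_iota in hu *.
elim: (iota 0 n) => [|a l IH] /=; first by split=> // -[].
rewrite IH; split=> [[<- | [u ul ->]] | [u]].
- by exists a; rewrite ?mem_head.
- by exists u; rewrite // in_cons ul orbT.
rewrite in_cons => /orP[/eqP -> -> | ul ->]; first by left.
by right; exists u.
Qed.

(** * The system of equations over GF(2) *)

Section System.
Variables (M : NTM) (k D : nat) (phi : aeform).
Hypothesis size_delta : forall q a b, size (@tm_delta M q a b) <= D.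

Implicit Type x : seq bool.

Definition sysW x := tape_bound k x.
Definition sysN x := ncodes M x (sysW x).
Definition sys0 x := encode M x (sysW x) (tm_start M) 0 0 0.

(* Variable 0 is false, variable 1 is true, and variable 2 + t * N + c is the
   parity of the number of accepting paths of length at most t from c. *)
Definition slot x (u r : nat) : nat :=
  let t := u %/ sysN x in let c := u %% sysN x in
  if r == 0 then u.+2
  else if nhlt M c then (if (r == 1) && nacc M c then 1 else 0)
  else if t == 0 then 0
  else if r.-1 < size (nsucc M x (sysW x) c)
    then (t.-1 * sysN x + nth 0 (nsucc M x (sysW x) c) r.-1).+2
    else 0.

Definition goal_var x : nat := (sysN x * sysN x + sys0 x).+2.

Definition equations x : seq aeform :=
  [:: AVar 1, subst (fun _ => AVar 0) phi &
     [seq subst (fun r => AVar (slot x u r)) phi | u <- iota 0 (sysN x * (sysN x).+1)]].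

Definition instance x : seq aeform := AL (AVar (goal_var x)) :: equations x.

Lemma LSl_enc_instance : LSl (fun x _ => enc_inst (instance x)).
Proof.
have hW : LS (fun x _ => sysW x) by exact: (LS_tape_bound k LSl_id).
have hN : LS (fun x _ => sysN x) by exact: (LS_ncodes M LSl_id hW).
have h0 : LS (fun x _ => sys0 x).
  by apply: (LS_encode M LSl_id hW); exact: LS_const.
have hslot r : LS (fun x v => slot x (nth 0 v 0) r).
  rewrite /slot; case: r => [|r]; first exact/LS_succ/LS_succ/LS_var.
  have hc : LS (fun x v => nth 0 v 0 %% sysN x) by apply: LS_mod => //; exact: LS_var.
  have ht : LS (fun x v => nth 0 v 0 %/ sysN x) by apply: LS_div => //; exact: LS_var.
  apply: LS_if; first exact: LSb_nhlt.
    apply: LS_if; [apply: LSb_and | exact: LS_const | exact: LS_const].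
      exact: LSb_const.
    exact: LSb_nacc.
  apply: LS_if; [by apply: LSb_eq => //; exact: LS_zero | exact: LS_zero |].
  apply: LS_if; [ | | exact: LS_zero].
    apply: LSb_ltn; first exact: LS_const.
    exact: (LS_size_nsucc M LSl_id hW hc).
  apply/LS_succ/LS_succ/LS_add; first by apply: LS_mul => //; apply: LS_pred.
  exact: (LS_nth_nsucc M LSl_id hW hc).
have heq : LSl (fun x _ => flatten
    [seq true :: enc_form (subst (fun r => AVar (slot x u r)) phi) |
      u <- iota 0 (sysN x * (sysN x).+1)]).
  apply: (LSl_flatten (G := fun x u _ =>
    true :: enc_form (subst (fun r => AVar (slot x u r)) phi))).
    by apply: LS_mul => //; apply: LS_succ.
  apply: (LSl_cat (LSl_const [:: true])).
  exact: (LSl_enc_subst (sigma := fun x v => slot x (nth 0 v 0))).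
have hg : LS (fun x _ => goal_var x) by apply/LS_succ/LS_succ/LS_add => //; apply: LS_mul.
have hF := LSl_enc_subst (sigma := fun _ _ _ => 0) phi (fun _ => LS_zero).
(* The five letters are the list marker, the tag of [AL] and the tag of [AVar]. *)
have hA := LSl_cat (LSl_const [:: true; true; false; false; false]) (LSl_enc_nat hg).
have h1 := LSl_const (true :: enc_form (AVar 1)).
have := LSl_cat (LSl_cat hA (LSl_cat h1 (LSl_cat (LSl_cat (LSl_const [:: true]) hF) heq)))
  (LSl_const [:: false]).
apply: LSl_ext => x v; rewrite /enc_inst /instance /equations /= -!catA /=.
by rewrite -map_comp.
Qed.

(** Slot 0 of the template is the unknown being determined; the others form the right-hand side of
    its equation, padded with the false variable 0. With [D.+1] there is room for the constant of a
    halting configuration even if [D] is 0. *)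
Lemma slots_sum x u vp : vp 0 = false -> vp 1 = true ->
  let c := u %% sysN x in let t := u %/ sysN x in
  \big[addb/false]_(r < (D.+1).*2) vp (slot x u r.+1) =
  if nhlt M c then nacc M c else if t == 0 then false else
  \big[addb/false]_(c' <- nsucc M x (sysW x) c) vp (t.-1 * sysN x + c').+2.
Proof.
move=> v0 v1 c t; rewrite /slot /= -/c -/t.
case: ifP => _.
  rewrite doubleS big_ord_recl /= big1 ?addbF => [|r _]; last by rewrite v0.
  by case: (nacc M c).
case: ifP => _; first by rewrite big1.
set s := nsucc M x (sysW x) c.
have le : size s <= (D.+1).*2.
  by rewrite size_map; apply: leq_trans (size_delta _ _ _) _; lia.
rewrite (big_nth 0) big_mkord.
rewrite (big_ord_widen _ (fun r => vp (t.-1 * sysN x + nth 0 s r).+2) le).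
by rewrite [RHS]big_mkcond /=; apply: eq_bigr => r _; case: ifP.
Qed.

Section Correctness.
Variables (B : seq BoolFun).
Hypotheses (wf_phi : wf B phi) (pure_phi : pure phi).
Hypothesis eval_phi : forall vp vL,
  eval B vp vL phi = ~~ \big[addb/false]_(r < ((D.+1).*2).+1) vp r.

Lemma eval_equation x u vp vL : vp 0 = false -> vp 1 = true ->
  eval B vp vL (subst (fun r => AVar (slot x u r)) phi) =
  (vp u.+2 == if nhlt M (u %% sysN x) then nacc M (u %% sysN x) else
   if u %/ sysN x == 0 then false else
  \big[addb/false]_(c' <- nsucc M x (sysW x) (u %% sysN x))
     vp ((u %/ sysN x).-1 * sysN x + c').+2).
Proof.
move=> v0 v1; rewrite eval_subst // eval_phi big_ord_recl (slots_sum _ _ v0 v1).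
by rewrite /slot /=; case: (vp u.+2); case: (if nhlt M _ then _ else _).
Qed.

Lemma sysN_gt0 x : 0 < sysN x.
Proof.
by apply: ncodes_gt0; apply: leq_trans (tape_boundP k x); rewrite expn_gt0.
Qed.

Lemma sysW_gt0 x : 0 < sysW x.
Proof. by apply: leq_trans (tape_boundP k x); rewrite expn_gt0. Qed.

Lemma equations_entail x :
  (forall vp, models B (equations x) vp -> vp (goal_var x)) <->
  odd (npaths M x (sysW x) (sysN x) (sys0 x)).
Proof.
set N := sysN x; have N0 : 0 < N := sysN_gt0 x.
have lt0 : sys0 x < N by apply: encode_lt; rewrite // sysW_gt0.
have divE t c : c < N -> (t * N + c) %/ N = t.
  by move=> h; rewrite divnMDl // divn_small ?addn0.
have modE t c : c < N -> (t * N + c) %% N = c by move=> h; rewrite modnMDl modn_small.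
have ltsucc c := nsucc_lt M x c (sysW_gt0 x).
split=> [h | hodd vp mvp].
  (* The parities of the path counts themselves solve the system, so an entailed goal holds for
     them. *)
  pose vp i := if i is u.+2 then odd (npaths M x (sysW x) (u %/ N) (u %% N)) else i == 1.
  have := h vp; rewrite /goal_var -/N /vp divE // modE //; apply.
  move=> sigma [<- // | [<- | /In_map_iota[u _ ->]]].
    by rewrite eval_subst // eval_phi big1.
  rewrite eval_equation // -/N; apply/eqP.
  case: (u %/ N) => [|t] /=; case: ifP => _ //; try by rewrite oddb.
  rewrite odd_sumn; apply: eq_big_seq => c' c's.
  by have lt := allP (ltsucc _) _ c's; rewrite /vp divE // modE.
have v1 : vp 1 by apply: (mvp (AVar 1)); left.
have v0 : vp 0 = false.
  (* Every slot of this equation holds variable 0. Their number [(D.+1).*2.+1] is odd, so the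
     vanishing of the sum makes variable 0 false; the doubling in the arity serves this purpose. *)
  have := mvp _ (or_intror (or_introl erefl)).
  rewrite eval_subst // eval_phi big_const_ord /=.
  have e n : iter n (addb true) false = odd n by elim: n => //= n ->; case: odd.
  by case: (vp 0) => //; rewrite e odd_double.
(* Uniqueness: the equations of time [t.+1] express its unknowns through those of time [t]. *)
suff H t c : c < N -> t <= N -> vp (t * N + c).+2 = odd (npaths M x (sysW x) t c).
  by rewrite /goal_var -/N H.
have eqn_at t' c' : c' < N -> t' <= N ->
    List.In (subst (fun r => AVar (slot x (t' * N + c') r)) phi) (equations x).
  move=> lc lt; right; right; apply/In_map_iota; exists (t' * N + c') => //.
  by rewrite -/N; have := leq_mul lt (leqnn N); nia.
elim: t c => [|t IH] c ltc ltt; have := mvp _ (eqn_at _ _ ltc ltt);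
  rewrite eval_equation // -/N modE // divE // => /eqP -> /=;
  case: ifP => _ //; try by rewrite oddb.
rewrite odd_sumn; apply: eq_big_seq => c' c's.
by rewrite IH ?(allP (ltsucc _) _ c's) // ltnW.
Qed.

Lemma wf_instance x : all (wf B) (instance x).
Proof.
rewrite /= wf_subst //= all_map; apply/allP => u _ /=.
exact: wf_subst.
Qed.

Lemma pure_equations x : all pure (equations x).
Proof.
rewrite /= pure_subst //= all_map; apply/allP => u _ /=.
exact: pure_subst.
Qed.

Lemma EXP_instance x : EXP B (enc_inst (instance x)) <->
  odd (npaths M x (sysW x) (sysN x) (sys0 x)).
Proof.
rewrite -equations_entail -(stable_expansion_entails B _ (pure_equations x)).
split=> [[S [_ [/enc_inst_inj -> ]]] // | h].
by exists (instance x); split; [exact: wf_instance | split].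
Qed.
End Correctness.
End System.

(** * Combining the reduction with the slice deciders *)

Lemma delta_bound (M : NTM) : exists D, forall q a b, size (@tm_delta M q a b) <= D.
Proof.
exists (\max_(t : 'I_(tm_ns M) * option bool * bool) size (@tm_delta M t.1.1 t.1.2 t.2)).
move=> q a b; exact: (leq_bigmax (F := fun t : 'I_(tm_ns M) * option bool * bool =>
  size (@tm_delta M t.1.1 t.1.2 t.2)) (q, a, b)).
Qed.

Lemma ParityL_reduces_to_EXP (B : seq BoolFun) (A : language) :
  in_clone B 2 xor_fun -> in_clone B 1 (fun _ => true) -> in_ParityL A ->
  exists inst : seq bool -> seq aeform,
    [/\ LSl (fun x _ => enc_inst (inst x)), forall x, all (wf B) (inst x) &
        forall x, A x <-> EXP B (enc_inst (inst x))].
Proof.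
move=> hX hT [M [k hM]]; have [D hD] := delta_bound M.
have [phi [w p e]] := parity_template hX hT (D.+1).*2.+1.
exists (instance M k phi); split.
- exact: LSl_enc_instance.
- by move=> x; exact: wf_instance.
move=> x; rewrite (EXP_instance k hD w p e).
have [fuel [g ->]] := hM x.
by rewrite (acc_paths_ncodes (tape_boundP k x) g).
Qed.

(** The value of [kappa] is not computed: the deciders of the slices below [c] are all consulted,
    and their answers are joined by a disjunction. *)
Lemma bounded_slices_in_L (P : language) (kappa : seq bool -> nat) G c :
  in_XLnu P kappa -> LSl G ->
  exists Q, LSb Q /\ forall x v, (P (G x v) /\ kappa (G x v) < c) <-> Q x v.
Proof.
move=> hP hG; elim: c => [|c [Q [hQ eQ]]].
  by exists (fun _ _ => false); split; [exact: LSb_const | split=> // -[]].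
have [R [hR eR]] := in_L_LSb (hP c) hG.
exists (fun x v => ~~ (~~ Q x v && ~~ R x v)); split.
  by apply: LSb_neg; apply: LSb_and; apply: LSb_neg.
move=> x v; rewrite negb_and !negbK ltnS leq_eqVlt; split.
  case=> Px /orP[/eqP ek | lt]; apply/orP; [right | left]; [exact/eR | exact/eQ].
by case/orP => [/eQ[Px ->] | /eR[Px ->]]; rewrite ?eqxx ?orbT.
Qed.

Theorem theorem7 (B : seq BoolFun) (kappa : seq bool -> nat) :
  in_clone B 2 xor_fun ->
  in_clone B 1 (fun _ => true) ->
  (exists c : nat, forall Sigma : seq aeform,
      all (wf B) Sigma -> kappa (enc_inst Sigma) < c) ->
  ~ L_eq_ParityL ->
  ~ in_XLnu (EXP B) kappa.
Proof.
move=> hX hT [c hc] neq hXL; apply: neq => A; split; first exact: in_L_ParityL.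
case/(ParityL_reduces_to_EXP hX hT) => inst [hl wfi hA].
have [Q [hQ eQ]] := bounded_slices_in_L c hXL hl.
apply: (LS_in_L hQ) => x; rewrite hA.
have -> : (nat_of_bool (Q x [::]) != 0) = Q x [::] by case: (Q x [::]).
(* The bound on [kappa] applies because the reduction only produces codes of sets of
   [B]-formulae. *)
by rewrite -(eQ x [::]); split=> [h | []] //; split=> //; apply: hc.
Qed.
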